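(* For $N\in\mathbb{Z}$, $$\mathrm{ind}(P_N\,\bar\partial_F\,P_N)=N,\qquad q\text{-}\mathrm{ind}(P_N\,\bar\partial_F\,P_N)=[N]_q.$$
   Context: Let $q>0$, $q\neq 1$, $[x]_q=\frac{q^x-q^{-x}}{q-q^{-1}}$. $\mathcal{U}_q(\mathrm{su}_2)$ is the Hopf *-algebra generated by $E,F,K,K^{-1}$ with $KK^{-1}=K^{-1}K=1$, $KE=qEK$, $FK=qKF$, $EF-FE=\frac{1}{q-q^{-1}}(K^2-K^{-2})$, $E^*=F$, $K^*=K$, $\Delta(E)=E\otimes K+K^{-1}\otimes E$, $\Delta(F)=F\otimes K+K^{-1}\otimes F$, $\Delta(K)=K\otimes K$, $\varepsilon(E)=\varepsilon(F)=\varepsilon(K-1)=0$, $S(K)=K^{-1}$, $S(E)=-qE$, $S(F)=-q^{-1}F$. $\mathcal{O}(\mathrm{SU}_q(2))$ is the coordinate Hopf *-algebra of quantum $\mathrm{SU}(2)$, generated by $a,b,c,d$ with $ab=qba$, $ac=qca$, $bd=qdb$, $cd=qdc$, $bc=cb$, $ad-da=(q-q^{-1})bc$, $ad-qbc=1$, $a^*=d$, $b^*=-qc$. It has the Peter-Weyl basis $t^l_{jk}$ ($l\in\frac12\mathbb{N}_0$, $j,k=-l,\dots,l$) of matrix elements of irreducible unitary corepresentations, with $t^{1/2}=\begin{pmatrix}a&b\\c&d\end{pmatrix}$ (indices $-\frac12,\frac12$). The Haar state is $h(t^0_{00})=1$, $h(t^l_{jk})=0$ for $l>0$; $v^l_{jk}=[2l+1]_q^{1/2}q^jt^l_{jk}$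 are orthonormal for $\langle x,y\rangle=h(x^*y)$. With $\alpha^l_j=([l-j]_q[l+j+1]_q)^{1/2}$, the left action is $E\triangleright v^l_{jk}=\alpha^l_kv^l_{j,k+1}$, $F\triangleright v^l_{jk}=\alpha^l_{k-1}v^l_{j,k-1}$, $K\triangleright v^l_{jk}=q^kv^l_{jk}$, and there is a commuting representation $f\mapsto\partial_f$ with $\partial_E(v^l_{jk})=-\alpha^l_{j-1}v^l_{j-1,k}$, $\partial_F(v^l_{jk})=-\alpha^l_jv^l_{j+1,k}$, $\partial_K(v^l_{jk})=q^{-j}v^l_{jk}$. For $N\in\mathbb{Z}$, $M_N=\{x:\partial_{K^2}(x)=q^{-N}x\}$ with Hilbert space closure $\overline{M}_N$; $\mathcal{O}(\mathrm{S}_q^2)=M_0$ is the standard Podleś sphere, acting on each $\overline{M}_N$ by left multiplication. Let $\mathbf{t}^{l}_{n}=(t^l_{n,-l},\dots,t^l_{n,l})$, $\mathbf{t}^{l*}_n$ its conjugate transpose (column), $\sigma_l(f)$ the matrix with $f\triangleright v^l_{nk}=\sum_j\sigma_l(f)_{jk}v^l_{nj}$, $\rho_l^\circ(f)=\sigma_l(K^{-1}S(f)K)$, and $P_N=\rho^\circ_{|N|/2}(K^{-1})\,\mathbf{t}^{|N|/2*}_{N/2}\,\mathbf{t}^{|N|/2}_{N/2}\,\rho^\circ_{|N|/2}(K)\in\mathrm{M}_{|N|+1\times|N|+1}(\mathcal{O}(\mathrm{S}_q^2))$, an idempotent. $\bar\partial_F$ is the closure of $\partial_F:M_{-1}\to\overline{M}_1$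 (the lower-left entry of the Dirac operator $D$, the closure of $\begin{pmatrix}0&\partial_E\\\partial_F&0\end{pmatrix}$ on $\overline{M}_{-1}\oplus\overline{M}_1$). It acts componentwise on $\overline{M}_{-1}^{|N|+1}$, and $P_N\bar\partial_FP_N$ is regarded as an unbounded Fredholm operator from its domain in $P_N\overline{M}_{-1}^{|N|+1}$ to $P_N\overline{M}_{1}^{|N|+1}$. An unbounded Fredholm operator $T$ has dense domain, finite-dimensional kernel and finite-codimensional range; $\mathrm{ind}(T)$ is the dimension of its kernel minus that of its cokernel (the latter identified with $\ker T^*$). If $T$ commutes with actions of $\mathcal{U}_q(\mathrm{su}_2)$, then $q\text{-}\mathrm{ind}(T)=\mathrm{Tr}_{\ker T}K^2-\mathrm{Tr}_{\ker T^*}K^2$ ($\ker T^*$ again identified with the cokernel). Here the action of $f\in\mathcal{U}_q(\mathrm{su}_2)$ on column vectors $\mathbf{x}\in M_{\pm1}^{|N|+1}$, which commutes with $P_N$ and $\partial_F$, is $\mathbf{x}\mapsto\sigma_l(K)\sigma_l(f_{(1)})\sigma_l(K^{-1})(f_{(2)}\triangleright\mathbf{x})$ with $l=|N|/2$; in particular $K^2$ acts by $\sigma_l(K^2)(K^2\triangleright\mathbf{x})$. *)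

(* Defs.v *)
From HB Require Import structures.
From mathcomp Require Import all_boot all_order all_algebra.
From mathcomp Require Import complex.
From mathcomp Require Import boolp classical_sets functions reals.
From mathcomp Require Import topology normedtype exp.

Set Implicit Arguments.
Unset Strict Implicit.
Unset Printing Implicit Defensive.

Import Order.TTheory GRing.Theory Num.Theory.
Import numFieldNormedType.Exports.

Local Open Scope classical_set_scope.
Local Open Scope complex_scope.
Local Open Scope ring_scope.

(** * q-numbers *)

Section QNumbers.
Context {R : realType}.

Definition qnum (q x : R) : R := (q `^ x - q `^ (- x)) / (q - q^-1).

(* The spin l is encoded by n = 2l : nat, and the weights j = -l, ..., l by
   the indices i : 'I_n.+1 through j = i - l. *)
Definition spin (n : nat) : R := n%:R / 2.
Definition wt (n i : nat) : R := i%:R - spin n.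

Definition alpha (q l j : R) : R :=
  Num.sqrt (qnum q (l - j) * qnum q (l + j + 1)).

End QNumbers.

(** * Algebras given by generators and relations, tensor squares *)

Section Algebras.
Context {R : realType}.
Local Notation C := R[i].

Definition generates (A : algType C) (G : set A) : Prop :=
  forall S : set A, G `<=` S -> S 1 ->
    (forall (c : C) x y, S x -> S y -> S (c *: x + y)) ->
    (forall x y, S x -> S y -> S (x * y)) -> S = setT.

(* The algebra tensor product A (x) A, with tinl x = x (x) 1 and
   tinr y = 1 (x) y, through its universal property. *)
Record tensor_square (A : algType C) := TensorSquare {
  tens_alg :> algType C;
  tinl : {lrmorphism A -> tens_alg};
  tinr : {lrmorphism A -> tens_alg};
  tens_comm : forall x y, tinl x * tinr y = tinr y * tinl x;
  tens_span : forall z, exists s : seq (A * A),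
    z = \sum_(p <- s) tinl p.1 * tinr p.2;
  tens_univ : forall (B : algType C) (f g : {lrmorphism A -> B}),
    (forall x y, f x * g y = g y * f x) ->
    exists k : {lrmorphism tens_alg -> B},
      (forall x, k (tinl x) = f x) /\ (forall x, k (tinr x) = g x) }.

Definition tens (A : algType C) (T : tensor_square A) (x y : A) : T :=
  tinl T x * tinr T y.

(* s lists the terms f_(1) (x) f_(2) of a Sweedler decomposition of z. *)
Definition sweedler (A : algType C) (T : tensor_square A)
    (z : T) (s : seq (A * A)) : Prop :=
  z = \sum_(p <- s) tens T p.1 p.2.

Record is_star (A : algType C) (st : A -> A) : Prop := IsStar {
  star_lin : forall (c : C) x y, st (c *: x + y) = c^* *: st x + st y;
  star_mul : forall x y, st (x * y) = st y * st x;
  star_inv : forall x, st (st x) = x }.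

Record is_antimorphism (A : algType C) (S : A -> A) : Prop := IsAntimorphism {
  anti_lin : forall (c : C) x y, S (c *: x + y) = c *: S x + S y;
  anti_one : S 1 = 1;
  anti_mul : forall x y, S (x * y) = S y * S x }.

Record is_rep (U : algType C) (V : lmodType C) (act : U -> V -> V) : Prop :=
  IsRep {
    rep_linl : forall (c : C) f g x,
      act (c *: f + g) x = c *: act f x + act g x;
    rep_linr : forall (c : C) f x y,
      act f (c *: x + y) = c *: act f x + act f y;
    rep_one : forall x, act 1 x = x;
    rep_mul : forall f g x, act (f * g) x = act f (act g x) }.

End Algebras.

(** * The Hopf *-algebras U_q(su_2) and O(SU_q(2)) *)

Section HopfAlgebras.
Context {R : realType}.
Local Notation C := R[i].

Record uq_rel (q : R) (B : algType C) (E F K Ki : B) : Prop := UqRel {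
  uq_KKi : K * Ki = 1;
  uq_KiK : Ki * K = 1;
  uq_KE : K * E = q%:C *: (E * K);
  uq_FK : F * K = q%:C *: (K * F);
  uq_EF : E * F - F * E = ((q - q^-1)^-1)%:C *: (K ^+ 2 - Ki ^+ 2) }.

Record UqSU2 (q : R) := MkUqSU2 {
  uq_alg :> algType C;
  uE : uq_alg; uF : uq_alg; uK : uq_alg; uKi : uq_alg;
  uq_gen : generates [set uE; uF; uK; uKi];
  uq_relP : uq_rel q uE uF uK uKi;
  uq_univ : forall (B : algType C) (E F K Ki : B), uq_rel q E F K Ki ->
    exists k : {lrmorphism uq_alg -> B},
      [/\ k uE = E, k uF = F, k uK = K & k uKi = Ki];
  uq_star : uq_alg -> uq_alg;
  uq_starP : is_star uq_star;
  uq_starE : uq_star uE = uF;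
  uq_starK : uq_star uK = uK;
  uq_tens : tensor_square uq_alg;
  uDelta : {lrmorphism uq_alg -> uq_tens};
  uDeltaE : uDelta uE = tens uq_tens uE uK + tens uq_tens uKi uE;
  uDeltaF : uDelta uF = tens uq_tens uF uK + tens uq_tens uKi uF;
  uDeltaK : uDelta uK = tens uq_tens uK uK;
  ueps : {lrmorphism uq_alg -> C | *%R};
  uepsE : ueps uE = 0;
  uepsF : ueps uF = 0;
  uepsK : ueps (uK - 1) = 0;
  uS : uq_alg -> uq_alg;
  uSP : is_antimorphism uS;
  uSK : uS uK = uKi;
  uSE : uS uE = - (q%:C *: uE);
  uSF : uS uF = - ((q^-1)%:C *: uF) }.

Record osuq_rel (q : R) (B : algType C) (a b c d : B) : Prop := OsuqRel {
  osuq_ab : a * b = q%:C *: (b * a);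
  osuq_ac : a * c = q%:C *: (c * a);
  osuq_bd : b * d = q%:C *: (d * b);
  osuq_cd : c * d = q%:C *: (d * c);
  osuq_bc : b * c = c * b;
  osuq_ad : a * d - d * a = (q - q^-1)%:C *: (b * c);
  osuq_det : a * d - q%:C *: (b * c) = 1 }.

(* The generators enter below through the matrix t^{1/2} = (a, b; c, d). *)
Definition mx22 (T : Type) (a b c d : T) : 'M[T]_2 :=
  \matrix_(i, j) if i == 0 then (if j == 0 then a else b)
                 else (if j == 0 then c else d).

Record OSUq2 (q : R) := MkOSUq2 {
  os_alg :> algType C;
  oa : os_alg; ob : os_alg; oc : os_alg; od : os_alg;
  os_gen : generates [set oa; ob; oc; od];
  os_relP : osuq_rel q oa ob oc od;
  os_univ : forall (B : algType C) (a b c d : B), osuq_rel q a b c d ->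
    exists k : {lrmorphism os_alg -> B},
      [/\ k oa = a, k ob = b, k oc = c & k od = d];
  ostar : os_alg -> os_alg;
  ostarP : is_star ostar;
  ostar_a : ostar oa = od;
  ostar_b : ostar ob = - (q%:C *: oc);
  os_tens : tensor_square os_alg;
  oDelta : {lrmorphism os_alg -> os_tens};
  oDeltaP : forall j k : 'I_2, let u := mx22 oa ob oc od in
    oDelta (u j k) = \sum_i tens os_tens (u j i) (u i k);
  oeps : {lrmorphism os_alg -> C | *%R};
  oepsP : forall j k : 'I_2, oeps (mx22 oa ob oc od j k) = (j == k)%:R }.

End HopfAlgebras.

(** * Peter-Weyl basis, Haar state, actions of U_q(su_2) *)

Section PeterWeyl.
Context {R : realType} {q : R}.
Local Notation C := R[i].

(* v^l_{jk} = [2l+1]_q^{1/2} q^j t^l_{jk} *)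
Definition vmx (A : OSUq2 q) (t : forall n, 'M[A]_n.+1)
    (n : nat) (j k : 'I_n.+1) : A :=
  (Num.sqrt (qnum q (2 * spin n + 1)) * q `^ (wt n j))%:C *: t n j k.

Record peter_weyl (A : OSUq2 q) := PeterWeyl {
  pw_t : forall n, 'M[A]_n.+1;
  pw_Delta : forall n (j k : 'I_n.+1), oDelta A (pw_t n j k) =
    \sum_i tens (os_tens A) (pw_t n j i) (pw_t n i k);
  pw_eps : forall n (j k : 'I_n.+1), oeps A (pw_t n j k) = (j == k)%:R;
  pw_unitaryr : forall n,
    pw_t n *m (map_mx (ostar (o := A)) (pw_t n))^T = 1%:M;
  pw_unitaryl : forall n,
    (map_mx (ostar (o := A)) (pw_t n))^T *m pw_t n = 1%:M;
  pw_half : pw_t 1 = mx22 (oa A) (ob A) (oc A) (od A);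
  pw_span : forall x : A, exists m (c : forall n : 'I_m, 'M[C]_n.+1),
    x = \sum_(n < m) \sum_j \sum_k c n j k *: pw_t n j k;
  pw_free : forall m (c : forall n : 'I_m, 'M[C]_n.+1),
    \sum_(n < m) \sum_j \sum_k c n j k *: pw_t n j k = 0 ->
    forall n, c n = 0;
  haar : {scalar A};
  haar_t0 : haar (pw_t 0 ord0 ord0) = 1;
  haar_t : forall n (j k : 'I_n.+1), (0 < n)%N -> haar (pw_t n j k) = 0;
  pw_orthonormal :
    forall n (j k : 'I_n.+1) n' (j' k' : 'I_n'.+1),
      haar (ostar (vmx pw_t j k) * vmx pw_t j' k') =
      [&& n == n', j == j' :> nat & k == k' :> nat]%:R }.

(* act is the left action, making A a U-module algebra (act_mul); pd is the
   representation f |-> partial_f; colact is the action on column vectors.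
   In the formulas for E and F the sums have at most one term; they are empty
   when the shifted weight is not among -l, ..., l. *)
Record uq_actions (U : UqSU2 q) (A : OSUq2 q) (W : peter_weyl A) :=
  UqActions {
    act : U -> A -> A;
    act_rep : is_rep act;
    act_mul : forall f s x y, sweedler (uDelta U f) s ->
      act f (x * y) = \sum_(p <- s) act p.1 x * act p.2 y;
    act_E : forall n (j k : 'I_n.+1), act (uE U) (vmx (pw_t W) j k) =
      \sum_(k' : 'I_n.+1 | k' == k.+1 :> nat)
        (alpha q (spin n) (wt n k))%:C *: vmx (pw_t W) j k';
    act_F : forall n (j k : 'I_n.+1), act (uF U) (vmx (pw_t W) j k) =
      \sum_(k' : 'I_n.+1 | k'.+1 == k :> nat)
        (alpha q (spin n) (wt n k - 1))%:C *: vmx (pw_t W) j k';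
    act_K : forall n (j k : 'I_n.+1), act (uK U) (vmx (pw_t W) j k) =
      (q `^ (wt n k))%:C *: vmx (pw_t W) j k;
    pd : U -> A -> A;
    pd_rep : is_rep pd;
    pd_act : forall f g x, pd f (act g x) = act g (pd f x);
    pd_E : forall n (j k : 'I_n.+1), pd (uE U) (vmx (pw_t W) j k) =
      \sum_(j' : 'I_n.+1 | j'.+1 == j :> nat)
        - (alpha q (spin n) (wt n j - 1))%:C *: vmx (pw_t W) j' k;
    pd_F : forall n (j k : 'I_n.+1), pd (uF U) (vmx (pw_t W) j k) =
      \sum_(j' : 'I_n.+1 | j' == j.+1 :> nat)
        - (alpha q (spin n) (wt n j))%:C *: vmx (pw_t W) j' k;
    pd_K : forall n (j k : 'I_n.+1), pd (uK U) (vmx (pw_t W) j k) =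
      (q `^ (- wt n j))%:C *: vmx (pw_t W) j k;
    sigma : forall n, U -> 'M[C]_n.+1;
    sigmaP : forall n f (i k : 'I_n.+1), act f (vmx (pw_t W) i k) =
      \sum_j sigma n f j k *: vmx (pw_t W) i j;
    colact : forall n, U -> 'cV[A]_n.+1 -> 'cV[A]_n.+1;
    colactP : forall n f s (x : 'cV[A]_n.+1), sweedler (uDelta U f) s ->
      colact f x = \sum_(p <- s)
        map_mx (in_alg A) (sigma n (uK U) *m sigma n p.1 *m sigma n (uKi U))
          *m map_mx (act p.2) x }.

(* The GNS Hilbert space of the Haar state. The forms of the library are
   linear in the first argument, so <x, y> = h(x^* y) is written dot y x. *)
Record gns_space (A : OSUq2 q) (W : peter_weyl A) := GnsSpace {
  gns_hilb :> completeNormedModType C;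
  gns_dot : {dot gns_hilb for (@Num.conj C)};
  gns_norm : forall x, `|x| ^+ 2 = gns_dot x x;
  gns_emb : {linear A -> gns_hilb};
  gns_embP : forall x y : A,
    gns_dot (gns_emb y) (gns_emb x) = haar W (ostar x * y);
  gns_dense : closure (range gns_emb) = setT;
  gns_lmul : A -> gns_hilb -> gns_hilb;
  gns_lmul_cont : forall x, continuous (gns_lmul x);
  gns_lmulP : forall x y : A, gns_lmul x (gns_emb y) = gns_emb (x * y) }.

End PeterWeyl.

(** * Unbounded Fredholm operators and their indices *)

(* Operators between subspaces X and Y of a finite direct sum H^m of a Hilbert
   space are given by their graphs. *)
Section Operators.
Context {R : realType}.
Local Notation C := R[i].
Variables (H : completeNormedModType C) (dot : {dot H for (@Num.conj C)}).
Variable (m : nat).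
Local Notation col := ('I_m -> H).

Definition cdot (x y : col) : C := \sum_i dot (x i) (y i).

Definition col_closure (S : set col) : set col :=
  closure (S : set {ptws 'I_m -> H}).

Definition col_graph_closure (S : set (col * col)) : set (col * col) :=
  closure (S : set ({ptws 'I_m -> H} * {ptws 'I_m -> H})).

Definition gdom (T : set (col * col)) : set col := [set x | exists y, T (x, y)].
Definition gran (T : set (col * col)) : set col := [set y | exists x, T (x, y)].
Definition gker (T : set (col * col)) : set col := [set x | T (x, 0)].

Definition is_operator (X Y : set col) (T : set (col * col)) : Prop :=
  [/\ T `<=` [set p | X p.1 /\ Y p.2],
      T (0, 0),
      forall (c : C) x y x' y', T (x, y) -> T (x', y') ->
        T (c *: x + x', c *: y + y') &
      forall x y y', T (x, y) -> T (x, y') -> y = y'].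

Definition adjoint (X Y : set col) (T : set (col * col)) : set (col * col) :=
  [set p | [/\ Y p.1, X p.2 &
    forall u w, T (u, w) -> cdot w p.1 = cdot u p.2]].

Definition is_basis d (V : set col) (e : 'I_d -> col) : Prop :=
  (forall c : 'I_d -> C, \sum_i c i *: e i = 0 -> forall i, c i = 0) /\
  V = [set x | exists c : 'I_d -> C, x = \sum_i c i *: e i].

Definition has_dim (V : set col) (d : nat) : Prop :=
  exists e : 'I_d -> col, is_basis V e.

(* dim (Y / V) = d for a subspace V of Y *)
Definition has_codim (Y V : set col) (d : nat) : Prop :=
  exists e : 'I_d -> col,
    [/\ forall i, Y (e i),
        forall c : 'I_d -> C, V (\sum_i c i *: e i) -> forall i, c i = 0 &
        forall y, Y y -> exists r (c : 'I_d -> C),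
          V r /\ y = r + \sum_i c i *: e i].

Definition fredholm (X Y : set col) (T : set (col * col)) : Prop :=
  [/\ is_operator X Y T,
      X `<=` col_closure (gdom T),
      exists d, has_dim (gker T) d &
      exists d, has_codim Y (gran T) d].

Definition is_index (Y : set col) (T : set (col * col)) (k : int) : Prop :=
  exists d d', [/\ has_dim (gker T) d, has_codim Y (gran T) d' &
    k = d%:Z - d'%:Z].

(* Tr_V G = tau for a finite-dimensional subspace V of the domain of G which
   is invariant under G *)
Definition has_trace (V : set col) (G : set (col * col)) (tau : C) : Prop :=
  exists d (e : 'I_d -> col) (g : 'M[C]_d),
    [/\ is_basis V e, forall j, G (e j, \sum_i g i j *: e i) & tau = \tr g].

End Operators.

(** * The operator P_N dF P_N *)

Unset Implicit Arguments.

Section ProjectedDirac.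
Context {R : realType} {q : R} {U : UqSU2 q} {A : OSUq2 q}.
Context {W : peter_weyl A}.
Variables (X : uq_actions U W) (H : gns_space W).
Local Notation C := R[i].
Local Notation emb := (gns_emb H).

Definition rho n (f : U) : 'M[C]_n.+1 := sigma X n (uKi U * uS f * uK U).

(* the index of the weight N/2 of the spin |N|/2 representation *)
Definition top_index (N : int) : 'I_(`|N|.+1) :=
  if 0 <= N then ord_max else ord0.

Definition trow (N : int) : 'rV[A]_(`|N|.+1) :=
  row (top_index N) (pw_t W `|N|).

Definition P_ (N : int) : 'M[A]_(`|N|.+1) :=
  map_mx (in_alg A) (rho `|N| (uKi U))
    *m (map_mx (ostar (o := A)) (trow N))^T *m trow N
    *m map_mx (in_alg A) (rho `|N| (uK U)).

Definition M_ (k : int) : set A :=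
  [set x | pd X (uK U ^+ 2) x = (q ^ (- k))%:C *: x].

Definition Mbar (k : int) : set H := closure (emb @` M_ k).

Definition dFbar : set (H * H) :=
  closure [set p : H * H | exists2 x, M_ (- 1) x &
    p = (emb x, emb (pd X (uF U) x))].

Definition mulcol {m} (P : 'M[A]_m) (x : 'I_m -> H) : 'I_m -> H :=
  fun i => \sum_j gns_lmul (P i j) (x j).

Definition embcol {m} (x : 'cV[A]_m) : 'I_m -> H := fun i => emb (x i 0).

Definition PMbar (N k : int) : set ('I_(`|N|.+1) -> H) :=
  mulcol (P_ N) @` [set x | forall i, Mbar k (x i)].

Definition PdFP (N : int) :
    set (('I_(`|N|.+1) -> H) * ('I_(`|N|.+1) -> H)) :=
  [set p | PMbar N (- 1) p.1 /\
    exists z, (forall i, dFbar (mulcol (P_ N) p.1 i, z i)) /\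
      p.2 = mulcol (P_ N) z].

(* K^2 as a closed operator on the columns with entries in Mbar k. The closure
   is needed since ker T^*, unlike ker T, need not consist of elements of
   O(SU_q(2)): the projections P_N are in general not self-adjoint. *)
Definition K2bar (n : nat) (k : int) :
    set (('I_n.+1 -> H) * ('I_n.+1 -> H)) :=
  col_graph_closure [set p | exists x : 'cV[A]_n.+1,
    (forall i, M_ k (x i 0)) /\
    p = (embcol x, embcol (colact X (uK U ^+ 2) x))].

Definition commutes_with_Uq {n} (T : set (('I_n.+1 -> H) * ('I_n.+1 -> H))) :
    Prop :=
  forall (f : U) x y, T (embcol x, embcol y) ->
    T (embcol (colact X f x), embcol (colact X f y)).

(* T is an operator from a subspace X1 of the columns over Mbar (-1) to a
   subspace Y1 of the columns over Mbar 1. *)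
Definition is_qindex {n} (X1 Y1 : set ('I_n.+1 -> H))
    (T : set (('I_n.+1 -> H) * ('I_n.+1 -> H))) (tau : C) : Prop :=
  commutes_with_Uq T /\
  exists tau1 tau2,
    [/\ has_trace (gker T) (K2bar n (- 1)) tau1,
        has_trace (gker (adjoint (gns_dot H) X1 Y1 T)) (K2bar n 1) tau2 &
        tau = tau1 - tau2].

End ProjectedDirac.

(* Main.v *)
Require Import Defs.
From HB Require Import structures.
From mathcomp Require Import all_boot all_order all_algebra.
From mathcomp Require Import complex.
From mathcomp Require Import boolp classical_sets functions reals.
From mathcomp Require Import topology normedtype exp sequences.
From mathcomp Require Import prodnormedzmodule ring zify.

Set Implicit Arguments.
Unset Strict Implicit.
Unset Printing Implicit Defensive.

Import Order.TTheory GRing.Theory Num.Theory.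
Import numFieldNormedType.Exports.

Local Open Scope classical_set_scope.
Local Open Scope complex_scope.
Local Open Scope ring_scope.

(** The idempotent P_N factors as phi psi with psi phi = 1, where, in terms of
    the row t_i = t^(|N|/2)_(N/2,i),

      phi y = (q^i t_i^* y)_i   and   psi x = sum_i q^-i t_i x_i .

    Hence phi identifies the closure of M_(k+N) with P_N applied to the columns
    over the closure of M_k. The operators partial_f satisfy a twisted Leibniz
    rule ([pdF_mul]), and unitarity of (t_ij) gives sum_i t_i partial_F(t_i^* ) = 0
    ([tN_pdF_tS]); therefore P_N partial_F P_N becomes, under phi, the multiple
    q^(N/2) of the closure of partial_F from M_(N-1) to M_(N+1) ([PdFP_E]).

    This last operator is a weighted shift: it sends v^l_(j,k) to
    - alpha^l_j v^l_(j+1,k), where j = (N-1)/2. The basis vectors annihilated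
    are those with l = j, which exist for N > 0 only; the basis vectors of
    M_(N+1) that are missed are those with l = - (j+1), which exist for N < 0
    only. In both cases 2l + 1 = |N| vectors are concerned, one for each k, and
    all other weights alpha are at least 1 ([alpha_ge1]). The lower bound passes
    to the closure, so the range is closed, and kernel and cokernel are exactly
    the expected ones ([Dgraph_ker], [Dgraph_range]). This gives the index.

    For the q-index, phi intertwines the left action with the twisted action on
    columns, because its components form a column of the inverse of an
    intertwining matrix ([phiA_act]). So K^2 has the eigenvalues q^(2k),
    k = -l, ..., l, on the kernel, and their sum is [N]_q. The kernel of the
    adjoint is less explicit, since phi is not isometric: phi x is orthogonal to
    the range iff (phi^* phi) x is a combination of the missed vectors w_k. Here
    phi^* phi is left multiplication by an element of the algebra which is
    bounded, coercive and of weight zero ([gram]), so z_k with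
    (phi^* phi) z_k = w_k is obtained by a Neumann iteration within the vectors
    of weight k ([gram_solve]). As a limit of weight vectors, phi z_k is an
    eigenvector of the closed operator K^2 with eigenvalue q^(2k)
    ([coker_trace]). *)

(** * q-numbers *)

Section QNumberFacts.
Context {R : realType}.
Variables (q : R).
Hypotheses (q_gt0 : 0 < q) (q_neq1 : q != 1).
Local Notation C := R[i].

Definition qpow (x : R) : C := (q `^ x)%:C.

Lemma powqD x y : q `^ (x + y) = q `^ x * q `^ y.
Proof. by rewrite powRD // (gt_eqF q_gt0) implybT. Qed.

Lemma qpowD x y : qpow (x + y) = qpow x * qpow y.
Proof. by rewrite /qpow powqD rmorphM. Qed.

Lemma qpow0 : qpow 0 = 1.
Proof. by rewrite /qpow powRr0. Qed.

Lemma qpow_neq0 x : qpow x != 0.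
Proof. by rewrite fmorph_eq0 gt_eqF // powR_gt0. Qed.

Lemma qpowN x : qpow (- x) = (qpow x)^-1.
Proof.
by apply: (mulfI (qpow_neq0 x)); rewrite -qpowD subrr qpow0 divff // qpow_neq0.
Qed.

Lemma qpowM2 x : qpow x ^+ 2 = qpow (x * 2).
Proof. by rewrite mulr_natr mulr2n qpowD expr2. Qed.

Lemma powq_inj : injective (fun x : R => q `^ x).
Proof.
move=> x y /(congr1 (@ln R)); rewrite !ln_powR; apply: mulIf.
by rewrite ln_eq0.
Qed.

Lemma qpow_inj : injective qpow.
Proof. by move=> x y [] /powq_inj. Qed.

Lemma conjC_real (x : R) : (x%:C)^* = x%:C.
Proof. by apply/eqP; rewrite eq_complex /= oppr0 !eqxx. Qed.

Lemma qpow_gt0 x : 0 < qpow x.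
Proof. by rewrite ltcR powR_gt0. Qed.

(** Numerator and denominator change sign together at q = 1, and x >= 1 makes
    the numerator the larger of the two in absolute value. *)
Lemma qnum_ge1 x : 1 <= x -> 1 <= qnum q x.
Proof.
move=> x1; rewrite /qnum powRN.
have q0 := ltW q_gt0; have [q1|q1] : 1 < q \/ q < 1.
  by case: (ltgtP q 1) q_neq1 => //; [right|left].
- have qi : q^-1 < 1 by rewrite invf_lt1.
  rewrite ler_pdivlMr ?subr_gt0 ?(lt_trans qi) // mul1r.
  have qx : q <= q `^ x by rewrite le1r_powR // ltW.
  by rewrite lerB // lef_pV2 // posrE powR_gt0.
- have qi : 1 < q^-1 by rewrite invf_gt1.
  rewrite ler_ndivlMr ?subr_lt0 ?(lt_trans q1) // mul1r.
  have qx : q `^ x <= q by rewrite ge1r_powR // q_gt0 ltW.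
  by rewrite lerB // lef_pV2 // posrE powR_gt0.
Qed.

(** Both q-numbers under the square root have integer arguments n - j and j + 1.
    This uniform lower bound is what makes the range of partial_F closed. *)
Lemma alpha_ge1 n j : (j < n)%N -> 1 <= alpha q (spin n) (wt n j).
Proof.
move=> jn; rewrite /alpha -[leLHS]sqrtr1 ler_wsqrtr //.
rewrite -[leLHS]mulr1 ler_pM // qnum_ge1 //.
  have -> : spin n - wt n j = (n - j)%:R :> R.
    by rewrite natrB 1?ltnW // /wt /spin; field.
  by rewrite ler1n subn_gt0.
have -> : spin n + wt n j = j%:R :> R by rewrite /wt addrC subrK.
by rewrite lerDr ler0n.
Qed.

Lemma qnum_spin_gt0 n : 0 < qnum q (2 * spin n + 1).
Proof.
apply: lt_le_trans (ltr01) (qnum_ge1 _).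
by rewrite lerDr /spin mulr_ge0 ?divr_ge0.
Qed.

Lemma wtS n j : wt n j.+1 = wt n j + 1 :> R.
Proof. by rewrite /wt -natr1 addrAC. Qed.

Lemma wt_eq n j m : (wt n j * 2 == m%:~R :> R) = ((j%:Z * 2 - n%:Z) == m).
Proof.
rewrite -(eqr_int R) rmorphB rmorphM /= -!pmulrn /wt /spin mulrBl.
by rewrite divfK ?pnatr_eq0.
Qed.

(** Multiplying by q - q^-1 makes the geometric progression telescope. The
    left-hand side is the trace of K^2 in the representation of spin n/2. *)
Lemma sum_qpow_wt n :
  \sum_(k < n.+1) qpow (wt n k * 2) = (qnum q n.+1%:R)%:C.
Proof.
have dn0 : q - q^-1 != 0.
  rewrite subr_eq0; apply: contra_neq q_neq1 => qq; apply/eqP.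
  rewrite -(@eqrXn2 _ 2) ?ltW // expr1n expr2 {2}qq.
  by rewrite divff // gt_eqF.
rewrite /qpow -(rmorph_sum (real_complex R)) /=; congr (_%:C).
apply: (mulIf dn0); rewrite /qnum divfK // mulr_suml.
pose g (i : nat) : R := q `^ (i%:R * 2 - n.+1%:R).
rewrite (eq_bigr (fun k : 'I_n.+1 => g k.+1 - g k)); last first.
  move=> k _; rewrite mulrBr /g; congr (_ - _).
    rewrite -[X in _ * X](@powRr1 _ q) ?ltW // -powqD; congr (q `^ _).
    by rewrite /wt /spin -!natr1; field.
  rewrite -[X in _ * X](@powR_inv1 _ q) ?ltW // -powqD; congr (q `^ _).
  by rewrite /wt /spin -!natr1; field.
rewrite -(big_mkord xpredT (fun k => g k.+1 - g k)) telescope_sumr // /g.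
by rewrite mul0r sub0r mulr_natr mulr2n addrK.
Qed.

End QNumberFacts.

(** * The Peter-Weyl basis *)

Section ActionsAreLinear.
Context {R : realType} {q : R} {U : UqSU2 q} {A : OSUq2 q}.
Context {W : peter_weyl A} (X : uq_actions U W).
Local Notation C := R[i].

Fact act_is_linear f : linear (act X f).
Proof. by move=> c x y; rewrite (rep_linr (act_rep X)). Qed.
HB.instance Definition _ f :=
  GRing.isLinear.Build C A A *:%R (act X f) (act_is_linear f).

Fact pd_is_linear f : linear (pd X f).
Proof. by move=> c x y; rewrite (rep_linr (pd_rep X)). Qed.
HB.instance Definition _ f :=
  GRing.isLinear.Build C A A *:%R (pd X f) (pd_is_linear f).

End ActionsAreLinear.

Section PeterWeylBasis.
Context {R : realType}.
Variables (q : R).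
Hypotheses (q_gt0 : 0 < q) (q_neq1 : q != 1).
Variables (A : OSUq2 q) (W : peter_weyl A) (H : gns_space W).
Local Notation C := R[i].
Local Notation emb := (gns_emb H).
Local Notation t := (pw_t W).

Definition vscale n (j : nat) : C :=
  (Num.sqrt (qnum q (2 * spin n + 1)) * q `^ (wt n j))%:C.

Lemma vscale_neq0 n j : vscale n j != 0.
Proof.
by rewrite fmorph_eq0 mulf_neq0 // gt_eqF ?powR_gt0 // sqrtr_gt0 qnum_spin_gt0.
Qed.

Lemma vscaleS n j : vscale n j.+1 = q%:C * vscale n j.
Proof.
by rewrite /vscale wtS powqD // powRr1 ?ltW // mulrA mulrC rmorphM.
Qed.

(** Indexing v^l_jk by natural numbers and extending it by zero spares the
    ladder operators a case distinction at the top weight, and lets elements be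
    expanded over boxes of indices of a non-dependent type. *)
Definition vbasis n j k : A :=
  if (j <= n)%N && (k <= n)%N then vmx t (inord j : 'I_n.+1) (inord k) else 0.

Local Notation vv := vbasis.

Lemma vvE n (j k : 'I_n.+1) : vv n j k = vmx t j k.
Proof. by rewrite /vbasis !leq_ord /= !inord_val. Qed.

Lemma vmx_t n (j k : 'I_n.+1) : vmx t j k = vscale n j *: t n j k.
Proof. by []. Qed.

Lemma t_vv n (j k : 'I_n.+1) : t n j k = (vscale n j)^-1 *: vv n j k.
Proof. by rewrite vvE vmx_t scalerA mulVf ?scale1r // vscale_neq0. Qed.

Lemma vv_out n j k : ~~ ((j <= n)%N && (k <= n)%N) -> vv n j k = 0.
Proof. by rewrite /vbasis => /negbTE ->. Qed.

Lemma vv_ind (P : A -> Prop) :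
  (forall c x y, P x -> P y -> P (c *: x + y)) ->
  (forall n (j k : 'I_n.+1), P (vv n j k)) -> forall x, P x.
Proof.
move=> Plin Pv.
have P0 : P 0.
  by have := Plin (- 1) _ _ (Pv 0 0 0) (Pv 0 0 0); rewrite scaleN1r addNr.
have PD x y : P x -> P y -> P (x + y).
  by move=> Px Py; have := Plin 1 x y Px Py; rewrite scale1r.
have PZ c x : P x -> P (c *: x).
  by move=> Px; have := Plin c x 0 Px P0; rewrite addr0.
move=> x; have [m [c ->]] := pw_span W x.
do 3!(apply: big_ind => // ? _).
by rewrite t_vv scalerA; apply/PZ/Pv.
Qed.

Definition ip (x y : A) : C := gns_dot H (emb x) (emb y).

Lemma ip_haar x y : ip x y = haar W (ostar y * x).
Proof. exact: gns_embP. Qed.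

Lemma ipZDl c x y z : ip (c *: x + y) z = c * ip x z + ip y z.
Proof. by rewrite /ip linearP linearDl linearZl_LR. Qed.

Lemma ipZDr c x y z : ip z (c *: x + y) = c^* * ip z x + ip z y.
Proof. by rewrite /ip linearP linearDr linearZr_LR. Qed.

Lemma ipC x y : ip x y = (ip y x)^*.
Proof. by rewrite /ip hermC mul1r. Qed.

Lemma ip_suml (I : Type) (s : seq I) P (F : I -> A) y :
  ip (\sum_(i <- s | P i) F i) y = \sum_(i <- s | P i) ip (F i) y.
Proof. by rewrite /ip linear_sum linear_sumlz. Qed.

Lemma ip_sumr (I : Type) (s : seq I) P (F : I -> A) y :
  ip y (\sum_(i <- s | P i) F i) = \sum_(i <- s | P i) ip y (F i).
Proof. by rewrite /ip linear_sum linear_sumr. Qed.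

Lemma ipZl c x y : ip (c *: x) y = c * ip x y.
Proof. by rewrite /ip linearZ linearZl_LR. Qed.

Lemma ipZr c x y : ip x (c *: y) = c^* * ip x y.
Proof. by rewrite /ip linearZ linearZr_LR. Qed.

Lemma ip0l x : ip 0 x = 0. Proof. by rewrite /ip linear0 linear0l. Qed.
Lemma ip0r x : ip x 0 = 0. Proof. by rewrite /ip linear0 linear0r. Qed.

Lemma ip_vv n j k n' j' k' : ip (vv n j k) (vv n' j' k') =
  [&& n == n', j == j', k == k', (j <= n)%N & (k <= n)%N]%:R.
Proof.
have [/andP[jn kn]|v0] := boolP ((j <= n)%N && (k <= n)%N); last first.
  by rewrite vv_out // ip0l !andbF.
have [/andP[jn' kn']|v0] := boolP ((j' <= n')%N && (k' <= n')%N).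
  rewrite /vbasis jn kn jn' kn' ip_haar pw_orthonormal /= !inordK // !andbT.
  by rewrite eq_sym [j == _]eq_sym [k == _]eq_sym.
rewrite [vv n' _ _]vv_out // ip0r andbT; case: and3P => // -[/eqP e1 /eqP e2 /eqP e3].
by move: v0; rewrite -e1 -e2 -e3 jn kn.
Qed.

Definition box (m : nat) : finType := ('I_m * 'I_m * 'I_m)%type.
Definition bv m (p : box m) : A := vv p.1.1 p.1.2 p.2.

Lemma ip_bv m (p p' : box m) :
  ip (bv p) (bv p') = (p == p')%:R * ((p.1.2 <= p.1.1)%N && (p.2 <= p.1.1)%N)%:R.
Proof.
case: p p' => [[n j] k] [[n' j'] k']; rewrite ip_vv /= -natrM mulnb.
by rewrite -!pair_eqE /= /pair_eq /= -!pair_eqE /= -!val_eqE /= !andbA.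
Qed.

(** The expansion is claimed for all large boxes, and not for one, because a
    linear combination has to be expanded over a box common to its terms. *)
Lemma expansion x : exists m0, forall m, (m0 <= m)%N ->
  x = \sum_(p : box m) ip x (bv p) *: bv p.
Proof.
elim/vv_ind: x => [c x y [m1 e1] [m2 e2]|n j k].
  exists (maxn m1 m2) => m; rewrite geq_max => /andP[/e1 ex /e2 ey].
  rewrite {1}ex {1}ey scaler_sumr -big_split; apply: eq_bigr => p _ /=.
  by rewrite ipZDl scalerDl scalerA.
exists n.+1 => m nm.
have jm : (j < m)%N by apply: leq_trans nm; rewrite ltn_ord.
have km : (k < m)%N by apply: leq_trans nm; rewrite ltn_ord.
pose p0 : box m := (Ordinal nm, Ordinal jm, Ordinal km).
rewrite (bigD1 p0) //= -/(bv p0) big1 => [|p pp0].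
  by rewrite addr0 ip_bv eqxx mul1r /= !leq_ord scale1r.
by rewrite -/(bv p0) ip_bv eq_sym (negbTE pp0) mul0r scale0r.
Qed.

(** Pythagoras. Besides the basis itself, its image under partial_F is
    orthogonal, with squared lengths alpha^2. *)
Lemma ip_orthogonal_sum (I : finType) (c : I -> C) (f : I -> A) (r : I -> C) :
  (forall p p', ip (f p) (f p') = (p == p')%:R * r p) ->
  ip (\sum_p c p *: f p) (\sum_p c p *: f p) = \sum_p `|c p| ^+ 2 * r p.
Proof.
move=> fo; rewrite ip_suml; apply: eq_bigr => p _.
rewrite ip_sumr (bigD1 p) //= big1 => [|p' pp'].
  by rewrite addr0 ipZl ipZr fo eqxx mul1r mulrA normCK.
by rewrite ipZl ipZr fo eq_sym (negbTE pp') mul0r !mulr0.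
Qed.

Lemma ip_eq0 x : ip x x = 0 -> x = 0.
Proof.
have [m /(_ m (leqnn m)) ex] := expansion x.
rewrite ex (ip_orthogonal_sum _ (@ip_bv m)) => /psumr_eq0P h.
apply: big1 => p _.
have /eqP : `|ip x (bv p)| ^+ 2 *
    ((p.1.2 <= p.1.1)%N && (p.2 <= p.1.1)%N)%:R = 0.
  by apply: h => // i _; rewrite mulr_ge0 ?exprn_ge0 // ler0n.
rewrite mulf_eq0 expf_eq0 /= normr_eq0 pnatr_eq0 eqb0.
by case/orP => [/eqP ->|/vv_out]; [rewrite scale0r|rewrite /bv => ->; rewrite scaler0].
Qed.

Lemma emb_inj : injective emb.
Proof.
move=> x y e; apply/eqP; rewrite -subr_eq0; apply/eqP/ip_eq0.
by rewrite /ip linearB e subrr linear0l.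
Qed.

End PeterWeylBasis.

(** * The actions of U_q(su_2) on the basis *)

Section ActionsOnBasis.
Context {R : realType}.
Variables (q : R).
Hypotheses (q_gt0 : 0 < q) (q_neq1 : q != 1).
Variables (U : UqSU2 q) (A : OSUq2 q) (W : peter_weyl A).
Variables (X : uq_actions U W).
Local Notation C := R[i].
Local Notation t := (pw_t W).
Local Notation vv := (vbasis W).
Local Notation qpow := (qpow q).
Local Notation K := (uK U).
Local Notation Ki := (uKi U).
Local Notation F := (uF U).

Let K_Ki : K * Ki = 1. Proof. exact: uq_KKi (uq_relP U). Qed.
Let Ki_K : Ki * K = 1. Proof. exact: uq_KiK (uq_relP U). Qed.

Lemma actK_vv n j k : act X K (vv n j k) = qpow (wt n k) *: vv n j k.
Proof.
rewrite /vbasis; case: ifP => [/andP[jn kn]|_]; last by rewrite linear0 scaler0.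
by rewrite act_K inordK.
Qed.

Lemma pdK_vv n j k : pd X K (vv n j k) = qpow (- wt n j) *: vv n j k.
Proof.
rewrite /vbasis; case: ifP => [/andP[jn kn]|_]; last by rewrite linear0 scaler0.
by rewrite pd_K inordK.
Qed.

Lemma inverse_eigen (V : lmodType C) (a : U -> V -> V) c x : is_rep a ->
  c != 0 -> a K x = c *: x -> a Ki x = c^-1 *: x.
Proof.
move=> ra c0 aK; have aZ f d y : a f (d *: y) = d *: a f y.
  have := rep_linr ra d f y 0; have := rep_linr ra 1 f 0 0.
  by rewrite !scale1r !addr0 -[X in X = _]addr0 => /addrI <-; rewrite addr0.
rewrite -[x in LHS]scale1r -(mulVf c0) -scalerA -aK aZ; congr (_ *: _).
by rewrite -(rep_mul ra) Ki_K (rep_one ra).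
Qed.

Lemma actKi_vv n j k : act X Ki (vv n j k) = qpow (- wt n k) *: vv n j k.
Proof.
by rewrite qpowN // (inverse_eigen (act_rep X) (qpow_neq0 _ _) (actK_vv _ _ _)).
Qed.

Lemma pdKi_vv n j k : pd X Ki (vv n j k) = qpow (wt n j) *: vv n j k.
Proof.
have := inverse_eigen (pd_rep X) (qpow_neq0 _ _) (pdK_vv n j k).
by rewrite -qpowN // opprK; apply.
Qed.

Lemma pdF_vv n j k :
  pd X F (vv n j k) = - (alpha q (spin n) (wt n j))%:C *: vv n j.+1 k.
Proof.
rewrite {1}/vbasis; case: ifP => [/andP[jn kn]|jk]; last first.
  rewrite linear0 vv_out ?scaler0 //; apply/negP => /andP[jn kn].
  by move: jk; rewrite kn (ltnW jn).
rewrite pd_F inordK //; have [jn'|jn'] := ltnP j n.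
  rewrite (big_pred1 (inord j.+1)) => [|i /=].
    by rewrite -vvE !inordK.
  by rewrite -val_eqE /= inordK.
rewrite vv_out ?scaler0; last by rewrite ltnNge jn'.
apply: big_pred0 => i; apply/eqP => ij; move: (ltn_ord i).
by rewrite ij ltnS ltnNge jn'.
Qed.

Lemma pdE_vv0 n k : pd X (uE U) (vv n 0 k) = 0.
Proof.
rewrite {1}/vbasis; case: ifP => [/andP[jn kn]|jk]; last by rewrite linear0.
by rewrite pd_E inordK // big_pred0.
Qed.

Lemma pdE_vvS n j k : (j < n)%N -> pd X (uE U) (vv n j.+1 k) =
  - (alpha q (spin n) (wt n j))%:C *: vv n j k.
Proof.
move=> jn; have [kn|kn] := leqP k n; last first.
  rewrite !vv_out ?linear0 ?scaler0 // negb_and orbC -ltnNge kn //.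
rewrite {1}/vbasis jn kn pd_E inordK //.
rewrite (big_pred1 (inord j)) => [|i /=].
  by rewrite -vvE !inordK ?(ltnW jn) ?wtS ?addrK // ltnS ltnW.
by rewrite eqSS -val_eqE /= inordK // ltnS ltnW.
Qed.

Lemma pdK_t n (j k : 'I_n.+1) : pd X K (t n j k) = qpow (- wt n j) *: t n j k.
Proof. by rewrite t_vv // linearZ /= pdK_vv !scalerA mulrC. Qed.

Lemma pdKi_t n (j k : 'I_n.+1) : pd X Ki (t n j k) = qpow (wt n j) *: t n j k.
Proof. by rewrite t_vv // linearZ /= pdKi_vv !scalerA mulrC. Qed.

Lemma actK_t n (j k : 'I_n.+1) : act X K (t n j k) = qpow (wt n k) *: t n j k.
Proof. by rewrite t_vv // linearZ /= actK_vv !scalerA mulrC. Qed.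

Lemma actKi_t n (j k : 'I_n.+1) : act X Ki (t n j k) = qpow (- wt n k) *: t n j k.
Proof. by rewrite t_vv // linearZ /= actKi_vv !scalerA mulrC. Qed.

Lemma actF_t n (j k : 'I_n.+1) : act X F (t n j k) =
  \sum_(k' : 'I_n.+1 | k'.+1 == k :> nat)
     (alpha q (spin n) (wt n k - 1))%:C *: t n j k'.
Proof.
rewrite t_vv // vvE linearZ /= act_F scaler_sumr; apply: eq_bigr => i _.
by rewrite -vvE !scalerA [_^-1 * _]mulrC -scalerA -t_vv.
Qed.

Lemma pdF_t n (j k : 'I_n.+1) : pd X F (t n j k) =
  \sum_(i : 'I_n.+1 | i == j.+1 :> nat)
     - (q * alpha q (spin n) (wt n j))%:C *: t n i k.
Proof.
rewrite t_vv // vvE linearZ /= pd_F scaler_sumr; apply: eq_bigr => i /eqP ij.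
rewrite -vvE -[in LHS](scale1r (vv n i k)) -(mulfV (vscale_neq0 q_gt0 q_neq1 n i)).
rewrite -scalerA -t_vv // !scalerA ij vscaleS // rmorphM /=; congr (_ *: _).
by move: (vscale q n j) (vscale_neq0 q_gt0 q_neq1 n j) => s s0; field.
Qed.

Lemma actM2 f g h x y : uDelta U f = tens (uq_tens U) g h ->
  act X f (x * y) = act X g x * act X h y.
Proof.
move=> df; rewrite (act_mul X (s := [:: (g, h)])) ?big_seq1 //.
by rewrite /sweedler big_seq1.
Qed.

(** The inverse of the group-like element K is group-like. *)
Lemma uDeltaKi : uDelta U Ki = tens (uq_tens U) Ki Ki.
Proof.
have KK : tens (uq_tens U) K K * tens (uq_tens U) Ki Ki = 1.
  rewrite /tens -mulrA (mulrA (tinr _ K)) -tens_comm -mulrA mulrA -!rmorphM.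
  by rewrite K_Ki !rmorph1 mulr1.
rewrite -[LHS]mulr1 -KK mulrA -uDeltaK -rmorphM Ki_K rmorph1 mul1r //.
Qed.

Lemma actK_mul x y : act X K (x * y) = act X K x * act X K y.
Proof. exact/actM2/uDeltaK. Qed.

Lemma actKi_mul x y : act X Ki (x * y) = act X Ki x * act X Ki y.
Proof. exact/actM2/uDeltaKi. Qed.

Lemma actF_mul x y : act X F (x * y) = act X F x * act X K y + act X Ki x * act X F y.
Proof.
rewrite (act_mul X (s := [:: (F, K); (Ki, F)])) ?big_cons ?big_nil ?addr0 //.
by rewrite /sweedler uDeltaF !big_cons big_nil addr0.
Qed.

Lemma act_K_Ki x : act X K (act X Ki x) = x.
Proof. by rewrite -(rep_mul (act_rep X)) K_Ki (rep_one (act_rep X)). Qed.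

Lemma act_Ki_K x : act X Ki (act X K x) = x.
Proof. by rewrite -(rep_mul (act_rep X)) Ki_K (rep_one (act_rep X)). Qed.

(** Ki fixes 1 because K |> (Ki |> 1) y = K |> y for all y, and K acts
    injectively. *)
Lemma actKi1 : act X Ki 1 = 1.
Proof.
have /(congr1 (act X Ki)) : act X K (act X Ki 1 * 1) = act X K 1.
  by rewrite actK_mul act_K_Ki mul1r.
by rewrite !act_Ki_K mulr1.
Qed.

Lemma actK1 : act X K 1 = 1.
Proof. by rewrite -{1}actKi1 act_K_Ki. Qed.

Lemma actF1 : act X F 1 = 0.
Proof.
have := actF_mul 1 1; rewrite mulr1 actK1 actKi1 mulr1 mul1r => e.
by apply: (addrI (act X F 1)); rewrite addr0 -e.
Qed.

End ActionsOnBasis.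

(** * The twisted Leibniz rule of partial_f *)

(** The universal property of the tensor square only produces algebra
    morphisms, whereas the convolution with the functional x |-> eps (F |> x)
    is not one. The coproduct of F makes this functional the off-diagonal entry
    of a morphism into upper triangular matrices, so matrices over A are given
    the structure of an algebra over C. *)
Section MatrixAlgebra.
Context {R : realType} (A : algType R[i]).
Local Notation C := R[i].

Definition algM2 : Type := 'M[A]_2.
HB.instance Definition _ := GRing.NzRing.on algM2.

Definition scaleM2 (c : C) (M : algM2) : algM2 := map_mx ( *:%R c) M.

Fact scaleM2A c d M : scaleM2 c (scaleM2 d M) = scaleM2 (c * d) M.
Proof. by apply/matrixP => i j; rewrite !mxE scalerA. Qed.
Fact scale1M2 : left_id 1 scaleM2.
Proof. by move=> M; apply/matrixP => i j; rewrite !mxE scale1r. Qed.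
Fact scaleM2Dr : right_distributive scaleM2 +%R.
Proof. by move=> c M P; apply/matrixP => i j; rewrite !mxE scalerDr. Qed.
Fact scaleM2Dl M : {morph scaleM2^~ M : c d / c + d}.
Proof. by move=> c d; apply/matrixP => i j; rewrite !mxE scalerDl. Qed.
HB.instance Definition _ := GRing.Zmodule_isLmodule.Build C algM2
  scaleM2A scale1M2 scaleM2Dr scaleM2Dl.

Fact scaleM2Al c (M P : algM2) : c *: (M * P) = (c *: M) * P.
Proof.
apply/matrixP => i j; rewrite !mxE scaler_sumr; apply: eq_bigr => k _.
by rewrite !mxE scalerAl.
Qed.
HB.instance Definition _ := GRing.Lmodule_isLalgebra.Build C algM2 scaleM2Al.

Fact scaleM2Ar c (M P : algM2) : c *: (M * P) = M * (c *: P).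
Proof.
apply/matrixP => i j; rewrite !mxE scaler_sumr; apply: eq_bigr => k _.
by rewrite !mxE scalerAr.
Qed.
HB.instance Definition _ := GRing.Lalgebra_isAlgebra.Build C algM2 scaleM2Ar.

Definition utri (a b d : A) : algM2 := mx22 a b 0 d.

Lemma utriM a b d a' b' d' :
  utri a b d * utri a' b' d' = utri (a * a') (a * b' + b * d') (d * d').
Proof.
apply/matrixP => i j; rewrite !mxE !big_ord_recl big_ord0 !mxE /= addr0.
by case: i j => [[|[|?]] ?] [[|[|?]] ?] //=; rewrite ?mulr0 ?mul0r ?addr0 ?add0r.
Qed.

Lemma utriZD c a b d a' b' d' :
  c *: utri a b d + utri a' b' d' = utri (c *: a + a') (c *: b + b') (c *: d + d').
Proof.
apply/matrixP => i j; rewrite !mxE.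
by case: i j => [[|[|?]] ?] [[|[|?]] ?] //=; rewrite scaler0 addr0.
Qed.

Lemma utri1 : utri 1 0 1 = 1.
Proof.
apply/matrixP => i j; rewrite !mxE -val_eqE /=.
by case: i j => [[|[|?]] ?] [[|[|?]] ?].
Qed.

Lemma utri0 : utri 0 0 0 = 0.
Proof.
apply/matrixP => i j; rewrite !mxE.
by case: i j => [[|[|?]] ?] [[|[|?]] ?].
Qed.

Lemma utri_sum (I : Type) (r : seq I) (a b d : I -> A) :
  \sum_(i <- r) utri (a i) (b i) (d i) =
  utri (\sum_(i <- r) a i) (\sum_(i <- r) b i) (\sum_(i <- r) d i).
Proof.
elim: r => [|i r IH]; rewrite ?big_nil ?utri0 // !big_cons IH.
by rewrite -[X in X + _]scale1r utriZD !scale1r.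
Qed.

Lemma utri_inj a b d a' b' d' : utri a b d = utri a' b' d' ->
  [/\ a = a', b = b' & d = d'].
Proof.
move=> /matrixP e; have := e 0 0; have := e 0 1; have := e 1 1.
by rewrite !mxE.
Qed.

End MatrixAlgebra.

Section Leibniz.
Context {R : realType}.
Variables (q : R).
Hypotheses (q_gt0 : 0 < q) (q_neq1 : q != 1).
Variables (U : UqSU2 q) (A : OSUq2 q) (W : peter_weyl A).
Variables (X : uq_actions U W).
Local Notation C := R[i].
Local Notation t := (pw_t W).
Local Notation K := (uK U).
Local Notation Ki := (uKi U).
Local Notation F := (uF U).
Local Notation eps := (oeps A).

Definition charF (x : A) : algM2 A :=
  utri (eps (act X Ki x))%:A (eps (act X F x))%:A (eps (act X K x))%:A.

Fact charF_linear : linear charF.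
Proof.
move=> c x y; rewrite /charF utriZD !linearP /=.
by rewrite !scalerDl !scalerA.
Qed.
HB.instance Definition _ :=
  GRing.isLinear.Build C A (algM2 A) *:%R charF charF_linear.

Fact charF_monoid_morphism : monoid_morphism charF.
Proof.
split=> [|x y]; rewrite /charF.
  by rewrite actKi1 actF1 actK1 rmorph1 rmorph0 scale1r scale0r utri1.
rewrite utriM actKi_mul actF_mul actK_mul !rmorphD !rmorphM /=.
rewrite ?scalerDl -!scalerAl -!scalerAr !mul1r !scalerA.
by rewrite addrC.
Qed.
HB.instance Definition _ :=
  GRing.isMonoidMorphism.Build A (algM2 A) charF charF_monoid_morphism.

Definition diagM2 (y : A) : algM2 A := utri y 0 y.

Fact diagM2_linear : linear diagM2.
Proof. by move=> c x y; rewrite /diagM2 utriZD scaler0 addr0. Qed.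
HB.instance Definition _ :=
  GRing.isLinear.Build C A (algM2 A) *:%R diagM2 diagM2_linear.

Fact diagM2_monoid_morphism : monoid_morphism diagM2.
Proof.
by split=> [|x y]; rewrite /diagM2 ?utri1 // utriM mulr0 mul0r addr0.
Qed.
HB.instance Definition _ :=
  GRing.isMonoidMorphism.Build A (algM2 A) diagM2 diagM2_monoid_morphism.

Let charF_diagM2_comm x y : charF x * diagM2 y = diagM2 y * charF x.
Proof.
rewrite /charF /diagM2 !utriM !mulr0 !mul0r !addr0 !add0r.
by rewrite -!scalerAl -!scalerAr !mul1r !mulr1.
Qed.

(** The left action moves the right index of t_jk and partial_f the left one,
    so partial_f is the convolution with a functional that can be read off from
    the left action through the counit. Hence applying charF (x) id to the
    coproduct gives, as an algebra morphism, the matrix with entries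
    partial_K x, - q^-1 partial_F x and partial_Ki x. *)
Lemma pd_utri : exists k : {lrmorphism A -> algM2 A}, forall x,
  k x = utri (pd X K x) (- (q^-1)%:C *: pd X F x) (pd X Ki x).
Proof.
have [k [kl kr]] := tens_univ (os_tens A) charF_diagM2_comm.
exists (k \o oDelta A) => x /=.
elim/(vv_ind q_gt0 q_neq1 (W := W)): x => [c x y ex ey|n i j].
  by rewrite !linearP /= ex ey utriZD.
suff e : k (oDelta A (t n i j)) = utri (pd X K (t n i j))
    (- (q^-1)%:C *: pd X F (t n i j)) (pd X Ki (t n i j)).
  by rewrite vvE vmx_t !linearZ /= e -[LHS]addr0 -utri0 utriZD !addr0 !scalerA mulrC.
rewrite pw_Delta linear_sum /=.
rewrite (eq_bigr (fun m => charF (t n i m) * diagM2 (t n m j))); last first.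
  by move=> m _; rewrite /tens rmorphM /= kl kr.
rewrite (eq_bigr _ (fun m _ => utriM _ _ _ _ _ _)) utri_sum; congr (utri _ _ _).
- rewrite pdK_t // (bigD1 i) //= actKi_t // linearZ /= pw_eps eqxx mulr1.
  rewrite -scalerAl mul1r big1 ?addr0 // => m mi.
  rewrite actKi_t // linearZ /= pw_eps eq_sym (negbTE mi) mulr0.
  by rewrite scale0r mul0r.
- rewrite pdF_t // scaler_sumr [RHS]big_mkcond /=; apply: eq_bigr => m _.
  rewrite mulr0 add0r actF_t // linear_sum /= -scalerAl mul1r.
  case: ifP => [/eqP mi|mi].
    rewrite (big_pred1 i) => [|l /=]; last by rewrite mi eqSS -val_eqE.
    rewrite linearZ /= pw_eps eqxx mulr1 mi wtS addrK scalerA rmorphM /=.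
    congr (_ *: _); rewrite mulrNN mulrA -rmorphM mulVf ?mul1r //.
    by rewrite gt_eqF.
  rewrite big1 ?scale0r // => l /eqP lm.
  rewrite linearZ /= pw_eps; have [il|_] := eqVneq i l; last by rewrite mulr0.
  by move: mi; rewrite -lm il eqxx.
- rewrite pdKi_t // (bigD1 i) //= actK_t // linearZ /= pw_eps eqxx mulr1.
  rewrite -scalerAl mul1r big1 ?addr0 // => m mi.
  rewrite actK_t // linearZ /= pw_eps eq_sym (negbTE mi) mulr0.
  by rewrite scale0r mul0r.
Qed.

Lemma pdK_mul x y : pd X K (x * y) = pd X K x * pd X K y.
Proof.
have [k e] := pd_utri; have /= := rmorphM k x y.
by rewrite !e utriM => /utri_inj [].
Qed.

Lemma pdK1 : pd X K 1 = 1.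
Proof.
have [k e] := pd_utri; have /= := rmorph1 k.
by rewrite e -utri1 => /utri_inj [].
Qed.

Lemma pdF1 : pd X F 1 = 0.
Proof.
have [k e] := pd_utri; have /= := rmorph1 k.
rewrite e -utri1 => /utri_inj [_ /eqP + _].
by rewrite scaler_eq0 oppr_eq0 fmorph_eq0 invr_eq0 gt_eqF // => /eqP.
Qed.

(** Off-diagonal entry of the product of two upper triangular matrices. *)
Lemma pdF_mul x y :
  pd X F (x * y) = pd X K x * pd X F y + pd X F x * pd X Ki y.
Proof.
have [k e] := pd_utri; have /= := rmorphM k x y.
rewrite !e utriM => /utri_inj [_ + _].
rewrite -scalerAr -scalerAl -scalerDr; apply: scalerI.
by rewrite oppr_eq0 fmorph_eq0 invr_eq0 gt_eqF.
Qed.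

End Leibniz.

(** * The spaces M_N *)

Section Spectral.
Context {R : realType}.
Variables (q : R).
Hypotheses (q_gt0 : 0 < q) (q_neq1 : q != 1).
Variables (U : UqSU2 q) (A : OSUq2 q) (W : peter_weyl A).
Variables (X : uq_actions U W) (H : gns_space W).
Local Notation C := R[i].
Local Notation t := (pw_t W).
Local Notation vv := (vbasis W).
Local Notation qpow := (qpow q).
Local Notation K := (uK U).
Local Notation Ki := (uKi U).
Local Notation F := (uF U).
Local Notation ip := (ip H).
Local Notation M_ := (M_ X).
Local Notation half m := (m%:~R / 2 : R).

Let mulr2 (x : R) : x * 2 = x + x.
Proof. by rewrite mulr_natr mulr2n. Qed.

(** A densely defined formal adjoint is what makes partial_F closable. *)
Lemma pdF_adjoint x y : ip (pd X F x) y = ip x (pd X (uE U) y).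
Proof.
elim/(vv_ind q_gt0 q_neq1 (W := W)): x => [c x x' ex ex'|n j k].
  by rewrite linearP !ipZDl ex ex'.
elim/(vv_ind q_gt0 q_neq1 (W := W)): y => [c y y' ey ey'|n' j' k'].
  by rewrite linearP !ipZDr ey ey'.
case: j k k' => [j jn] [k kn] [k' kn'] /=.
rewrite pdF_vv ipZl; case: j' => [[|j'] /= jn'].
  by rewrite pdE_vv0 ip0r ip_vv andbF mulr0.
rewrite pdE_vvS // ipZr !ip_vv eqSS rmorphN /= conjC_real.
have [->|_] /= := eqVneq n n'; last by rewrite !mulr0.
have [->|_] /= := eqVneq j j'; last by rewrite !mulr0.
have jn2 : (j' < n')%N by [].
by rewrite jn2 (ltnW jn2).
Qed.

Lemma pdK_symm x n j k :
  ip (pd X K x) (vv n j k) = qpow (- wt n j) * ip x (vv n j k).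
Proof.
elim/(vv_ind q_gt0 q_neq1 (W := W)): x => [c x x' ex ex'|n' j' k'].
  by rewrite linearP !ipZDl ex ex' mulrDr mulrCA.
rewrite pdK_vv ipZl; move: (nat_of_ord j') (nat_of_ord k') => {}j' {}k'.
rewrite !ip_vv; case: and5P => [|_]; last by rewrite !mulr0.
by case=> /eqP -> /eqP ->.
Qed.

Lemma M_E m x : M_ m x <-> pd X K (pd X K x) = qpow (- m%:~R) *: x.
Proof.
rewrite /Defs.M_ /= expr2 (rep_mul (pd_rep X)) /qpow -powR_intmul ?ltW //.
by rewrite rmorphN.
Qed.

(** partial_K is diagonal in the orthonormal basis, with eigenvalues that are
    different for different weights because q is not 1. This description of
    M_m survives passage to limits. *)
Lemma M_P m x : M_ m x <->
  forall n j k, j%:Z * 2 - n%:Z != m -> ip x (vv n j k) = 0.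
Proof.
split=> [/M_E xm n j k nm|x0].
  have := pdK_symm (pd X K x) n j k; rewrite xm ipZl pdK_symm mulrA -qpowD //.
  move=> e; apply/eqP; apply: contraR nm => v0.
  rewrite -(wt_eq (R := R)); move/(mulIf v0)/(qpow_inj q_gt0 q_neq1) : e.
  by rewrite -opprD => /oppr_inj ->; rewrite mulr2.
apply/M_E; have [b /(_ b (leqnn b)) ->] := expansion q_gt0 q_neq1 H x.
rewrite !(linear_sum (pd X K)) scaler_sumr; apply: eq_bigr => p _.
rewrite !(linearZ_LR (pd X K)) /=; have [wp|/x0 ->] := eqVneq (p.1.2%:Z * 2 - p.1.1%:Z) m; last by rewrite !scale0r scaler0.
rewrite /bv pdK_vv (linearZ_LR (pd X K)) /= pdK_vv !scalerA -mulrA -qpowD //.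
move/eqP: wp; rewrite -(wt_eq (R := R)) => /eqP <-.
by rewrite [qpow (- (_ * 2)) * _]mulrC -opprD -mulr2.
Qed.

Lemma M_pdK m x : M_ m x -> pd X K x = qpow (- half m) *: x.
Proof.
move=> /M_P x0; have [b /(_ b (leqnn b)) ->] := expansion q_gt0 q_neq1 H x.
rewrite !(linear_sum (pd X K)) scaler_sumr; apply: eq_bigr => p _.
rewrite !(linearZ_LR (pd X K)) /=; have [wp|/x0 ->] := eqVneq (p.1.2%:Z * 2 - p.1.1%:Z) m; last by rewrite !scale0r scaler0.
rewrite /bv pdK_vv !scalerA mulrC; congr (qpow (- _) * _ *: _).
by move/eqP: wp; rewrite -(wt_eq (R := R)) => /eqP <-; rewrite mulfK ?pnatr_eq0.
Qed.

Lemma pdK_M m x : pd X K x = qpow (- half m) *: x -> M_ m x.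
Proof.
move=> e; apply/M_E; rewrite e linearZ /= e scalerA -qpowD // -opprD.
by rewrite -mulr2 divfK ?pnatr_eq0.
Qed.

Lemma M_pdKi m x : M_ m x -> pd X Ki x = qpow (half m) *: x.
Proof.
move=> /M_pdK /(inverse_eigen (pd_rep X) (qpow_neq0 q_gt0 _)).
by rewrite -qpowN // opprK.
Qed.

Lemma M_lin m c x y : M_ m x -> M_ m y -> M_ m (c *: x + y).
Proof.
by move=> /M_E ex /M_E ey; apply/M_E; rewrite !(linearP (pd X K)) /= ex ey scalerDr !scalerA mulrC.
Qed.

Lemma M_0 m : M_ m 0.
Proof. by apply/M_E; rewrite !(linear0 (pd X K)) scaler0. Qed.

Lemma M_Z m c x : M_ m x -> M_ m (c *: x).
Proof. by move=> xm; rewrite -[_ *: _]addr0; apply: M_lin => //; apply: M_0. Qed.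

Lemma M_D m x y : M_ m x -> M_ m y -> M_ m (x + y).
Proof. by move=> xm ym; rewrite -[x]scale1r; apply: M_lin. Qed.

Lemma M_sum m (I : Type) (s : seq I) (P : pred I) (f : I -> A) :
  (forall i, P i -> M_ m (f i)) -> M_ m (\sum_(i <- s | P i) f i).
Proof.
by move=> fm; apply: big_ind => //; [apply: M_0|apply: M_D].
Qed.

Lemma M_vv m n j k : j%:Z * 2 - n%:Z = m -> M_ m (vv n j k).
Proof.
move/eqP; rewrite -(wt_eq (R := R)) => /eqP jm; apply: pdK_M.
by rewrite pdK_vv -jm mulfK ?pnatr_eq0.
Qed.

Lemma M_mul m m' x y : M_ m x -> M_ m' y -> M_ (m + m') (x * y).
Proof.
move=> /M_pdK xm /M_pdK ym; apply: pdK_M.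
rewrite pdK_mul // xm ym -scalerAl -scalerAr scalerA -qpowD // -opprD.
by rewrite -mulrDl -rmorphD.
Qed.

Lemma M_pdF m x : M_ m x -> M_ (m + 2) (pd X F x).
Proof.
move=> /M_P xm; apply/M_P => n j k; rewrite pdF_adjoint.
have [jn|jn] := leqP j n; last first.
  by move=> _; rewrite vv_out ?linear0 ?ip0r // negb_and -ltnNge jn.
case: j jn => [|j] jn jm; first by rewrite pdE_vv0 ip0r.
rewrite pdE_vvS // ipZr xm ?mulr0 //; apply: contra jm => /eqP <-.
by apply/eqP; lia.
Qed.

Lemma M_act m f x : M_ m x -> M_ m (act X f x).
Proof.
by move=> /M_pdK e; apply: pdK_M; rewrite pd_act e linearZ.
Qed.

Lemma t_star_sum n (i j : 'I_n.+1) :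
  \sum_k t n i k * ostar (t n j k) = (i == j)%:R.
Proof.
have /matrixP/(_ i j) := pw_unitaryr W n; rewrite !mxE => <-.
by apply: eq_bigr => k _; rewrite !mxE.
Qed.

Lemma star_t_sum n (i j : 'I_n.+1) :
  \sum_k ostar (t n k i) * t n k j = (i == j)%:R.
Proof.
have /matrixP/(_ i j) := pw_unitaryl W n; rewrite !mxE => <-.
by apply: eq_bigr => k _; rewrite !mxE.
Qed.

(** Let S = (t_ji^* ) be the inverse of the matrix t. If th t = D t with D
    diagonal, then applying th to t S = 1 gives th S = S D^-1; in the same way
    th t = t D gives th S = D^-1 S. This yields the weights of the t_ij^*
    for both actions. *)
Lemma row_eigen_star (th : {linear A -> A}) n (c : 'I_n.+1 -> C) :
  {morph th : x y / x * y} -> th 1 = 1 -> (forall i, c i != 0) ->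
  (forall i j, th (t n i j) = c i *: t n i j) ->
  forall i j, th (ostar (t n i j)) = (c i)^-1 *: ostar (t n i j).
Proof.
move=> thM th1 c0 tht i j.
have e l : \sum_k t n l k * th (ostar (t n i k)) = ((c l)^-1 * (l == i)%:R)%:A.
  transitivity ((c l)^-1 *: th (\sum_k t n l k * ostar (t n i k))).
    rewrite linear_sum scaler_sumr; apply: eq_bigr => k _ /=.
    by rewrite thM tht -scalerAl scalerA mulVf ?scale1r.
  rewrite t_star_sum -scalerA scaler_nat; case: (l == i); rewrite ?th1 //.
  by rewrite linear0.
transitivity (\sum_k ostar (t n k j) * \sum_m t n k m * th (ostar (t n i m))).
  under [RHS]eq_bigr => k _ do rewrite mulr_sumr.
  rewrite exchange_big /= (bigD1 j) //= [X in _ + X]big1 => [|m mj].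
    rewrite addr0; under [RHS]eq_bigr => k _ do rewrite mulrA.
    by rewrite -mulr_suml star_t_sum eqxx mul1r.
  under eq_bigr => k _ do rewrite mulrA.
  by rewrite -mulr_suml star_t_sum eq_sym (negbTE mj) mul0r.
under eq_bigr => k _ do rewrite e -scalerAr mulr1.
rewrite (bigD1 i) //= big1 => [|k ki]; first by rewrite eqxx mulr1 addr0.
by rewrite (negbTE ki) mulr0 scale0r.
Qed.

Lemma col_eigen_star (th : {linear A -> A}) n (c : 'I_n.+1 -> C) :
  {morph th : x y / x * y} -> th 1 = 1 -> (forall i, c i != 0) ->
  (forall i j, th (t n i j) = c j *: t n i j) ->
  forall i j, th (ostar (t n i j)) = (c j)^-1 *: ostar (t n i j).
Proof.
move=> thM th1 c0 tht i j.
have e l : \sum_k th (ostar (t n k j)) * t n k l = ((c l)^-1 * (j == l)%:R)%:A.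
  transitivity ((c l)^-1 *: th (\sum_k ostar (t n k j) * t n k l)).
    rewrite linear_sum scaler_sumr; apply: eq_bigr => k _ /=.
    by rewrite thM tht -scalerAr scalerA mulVf ?scale1r.
  rewrite star_t_sum -scalerA scaler_nat; case: (j == l); rewrite ?th1 //.
  by rewrite linear0.
transitivity (\sum_k (\sum_m th (ostar (t n m j)) * t n m k) * ostar (t n i k)).
  under [RHS]eq_bigr => k _ do rewrite mulr_suml.
  rewrite exchange_big /= (bigD1 i) //= [X in _ + X]big1 => [|m mi].
    rewrite addr0; under [RHS]eq_bigr => k _ do rewrite -mulrA.
    by rewrite -mulr_sumr t_star_sum eqxx mulr1.
  under eq_bigr => k _ do rewrite -mulrA.
  by rewrite -mulr_sumr t_star_sum (negbTE mi) mulr0.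
under eq_bigr => k _ do rewrite e -scalerAl mul1r.
rewrite (bigD1 j) //= big1 => [|k kj]; first by rewrite eqxx mulr1 addr0.
by rewrite eq_sym (negbTE kj) mulr0 scale0r.
Qed.

Lemma pdK_star n (i j : 'I_n.+1) :
  pd X K (ostar (t n i j)) = qpow (wt n i) *: ostar (t n i j).
Proof.
rewrite (row_eigen_star (th := pd X K) (c := fun i => qpow (- wt n i))) //=.
- by rewrite -qpowN // opprK.
- exact: pdK_mul.
- exact: pdK1.
- by move=> ?; apply: qpow_neq0.
- exact: pdK_t.
Qed.

Lemma actK_star n (i j : 'I_n.+1) :
  act X K (ostar (t n i j)) = qpow (- wt n j) *: ostar (t n i j).
Proof.
rewrite (col_eigen_star (th := act X K) (c := fun i => qpow (wt n i))) //=.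
- by rewrite -qpowN.
- exact: actK_mul.
- exact: actK1.
- by move=> ?; apply: qpow_neq0.
- exact: actK_t.
Qed.

End Spectral.

(** * The idempotent P_N *)

Section Projection.
Context {R : realType}.
Variables (q : R).
Hypotheses (q_gt0 : 0 < q) (q_neq1 : q != 1).
Variables (U : UqSU2 q) (A : OSUq2 q) (W : peter_weyl A).
Variables (X : uq_actions U W) (H : gns_space W) (N : int).
Local Notation C := R[i].
Local Notation t := (pw_t W).
Local Notation vv := (vbasis W).
Local Notation qpow := (qpow q).
Local Notation K := (uK U).
Local Notation Ki := (uKi U).
Local Notation F := (uF U).
Local Notation ip := (ip H).
Local Notation M_ := (M_ X).
Local Notation half m := (m%:~R / 2 : R).
Local Notation d := (`|N|%N).
Local Notation top := (top_index N).

Definition tN (i : 'I_d.+1) : A := t d top i.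
Definition tS (i : 'I_d.+1) : A := ostar (tN i).

Lemma wt_top : wt d top = half N.
Proof.
apply: (@mulIf _ 2); rewrite ?pnatr_eq0 // divfK ?pnatr_eq0 //.
apply/eqP; rewrite wt_eq /top_index; case: ifP => N0 /=; apply/eqP; lia.
Qed.

Lemma M_tN i : M_ N (tN i).
Proof. by apply: pdK_M => //; rewrite pdK_t // wt_top. Qed.

Lemma M_tS i : M_ (- N) (tS i).
Proof. by apply: pdK_M => //; rewrite pdK_star // wt_top rmorphN mulNr opprK. Qed.

Lemma tN_tS : \sum_i tN i * tS i = 1.
Proof. by rewrite /tN /tS t_star_sum eqxx. Qed.

(** partial_F turns row top of (t_ij) into a multiple of another row, and the
    rows are orthogonal. *)
Lemma pdF_tN_tS : \sum_i pd X F (tN i) * tS i = 0.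
Proof.
under eq_bigr => i _ do rewrite pdF_t // mulr_suml.
rewrite exchange_big /= big1 // => m /eqP mt.
under eq_bigr => i _ do rewrite -scalerAl.
rewrite -scaler_sumr t_star_sum; case: eqP => [mt'|_]; last by rewrite scaler0.
by case: (n_Sn (top : nat)); rewrite -mt {1}mt'.
Qed.

(** Apply partial_F to the sum of the tN i * tS i, which is 1. *)
Lemma tN_pdF_tS : \sum_i tN i * pd X F (tS i) = 0.
Proof.
have := pdF1 q_gt0 q_neq1 X; rewrite -tN_tS linear_sum /=.
under eq_bigr => i _ do rewrite pdF_mul // (M_pdK _ _ H (M_tN i)) //
  (M_pdKi _ _ H (M_tS i)) // -scalerAl -scalerAr.
rewrite big_split /= -!scaler_sumr pdF_tN_tS scaler0 addr0 => /eqP.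
by rewrite scaler_eq0 (negbTE (qpow_neq0 _ _)) // => /eqP.
Qed.

(** Up to completion, P_N = phi psi and psi phi = 1, so P_N M_k^(|N|+1) is a
    copy of M_(k+N). The powers of q are the entries of the diagonal matrices
    rho(K^-1) and rho(K). *)
Definition phiA (y : A) : 'cV[A]_d.+1 := \col_i (qpow (wt d i) *: (tS i * y)).
Definition psiA (x : 'cV[A]_d.+1) : A :=
  \sum_(i < d.+1) qpow (- wt d i) *: (tN i * x i 0).

Lemma phiAE y i j : phiA y i j = qpow (wt d i) *: (tS i * y).
Proof. by rewrite mxE. Qed.

Lemma M_phiA m y i : M_ m y -> M_ (m - N) (phiA y i 0).
Proof.
by move=> ym; rewrite phiAE addrC; apply: M_Z => //; apply: M_mul => //; apply: M_tS.
Qed.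

(** The second term of the twisted Leibniz rule is annihilated by psi, because
    of tN_pdF_tS; so P_N compresses partial_F to a multiple of itself. *)
Lemma pdF_phiA m y i : M_ m y -> pd X F (phiA y i 0) =
  qpow (half N) *: phiA (pd X F y) i 0
  + (qpow (wt d i) * qpow (half m)) *: (pd X F (tS i) * y).
Proof.
move=> ym; rewrite !phiAE linearZ /= pdF_mul // (M_pdK q_gt0 q_neq1 H (M_tS i)).
rewrite (M_pdKi q_gt0 q_neq1 H ym) rmorphN mulNr opprK scalerDr.
by rewrite -scalerAl -scalerAr !scalerA [qpow (half N) * _]mulrC.
Qed.

Lemma pdF_psi_term m x i : M_ m x -> pd X F (tN i * x) =
  qpow (- half N) *: (tN i * pd X F x) + qpow (half m) *: (pd X F (tN i) * x).
Proof.
move=> xm; rewrite pdF_mul // (M_pdK q_gt0 q_neq1 H (M_tN i)).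
by rewrite (M_pdKi q_gt0 q_neq1 H xm) -scalerAl -scalerAr.
Qed.

Lemma sigma_ip n f (j k : 'I_n.+1) :
  sigma X n f j k = ip (act X f (vv n 0 k)) (vv n 0 j).
Proof.
rewrite -[0%N]/(val (@ord0 n)) vvE (sigmaP X) ip_suml (bigD1 j) //= big1 => [|i ij].
  by rewrite -!vvE ipZl ip_vv !eqxx !leq_ord addr0 mulr1.
by rewrite -!vvE ipZl ip_vv /= val_eqE (negbTE ij) andbF mulr0.
Qed.

Lemma sigmaK n (j k : 'I_n.+1) :
  sigma X n K j k = qpow (wt n k) *+ (j == k).
Proof.
rewrite sigma_ip actK_vv ipZl ip_vv eqxx !leq_ord !andbT /= eq_sym val_eqE.
by rewrite mulr_natr.
Qed.

Lemma sigmaKi n (j k : 'I_n.+1) :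
  sigma X n Ki j k = qpow (- wt n k) *+ (j == k).
Proof.
rewrite sigma_ip actKi_vv // ipZl ip_vv eqxx !leq_ord !andbT /= eq_sym val_eqE.
by rewrite mulr_natr.
Qed.

Lemma rhoK n : rho X n K = sigma X n Ki.
Proof. by rewrite /rho uSK -mulrA (uq_KiK (uq_relP U)) mulr1. Qed.

Lemma uSKi : uS Ki = K.
Proof.
have [_ S1 SM] := @uSP _ _ U; have := SM K Ki; rewrite (uq_KKi (uq_relP U)) S1 uSK.
by move/(congr1 (fun z => z * K)); rewrite mul1r -mulrA (uq_KiK (uq_relP U)) mulr1.
Qed.

Lemma rhoKi n : rho X n Ki = sigma X n K.
Proof. by rewrite /rho uSKi (uq_KiK (uq_relP U)) mul1r. Qed.

(** sigma(K) and sigma(Ki) are diagonal, so that each sum in the matrix product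
    collapses to one term. *)
Lemma P_E i j : P_ X N i j = (qpow (wt d i) * qpow (- wt d j)) *: (tS i * tN j).
Proof.
have dsum m (D : 'I_d.+1 -> 'I_d.+1 -> C) (c : C) (f : 'I_d.+1 -> A) :
    (forall k, D m k = c *+ (m == k)) -> \sum_k (D m k)%:A * f k = c *: f m.
  move=> De; rewrite (bigD1 m) //= De eqxx mulr1n mulr_algl big1 ?addr0 // => k km.
  by rewrite De eq_sym (negbTE km) mulr0n scale0r mul0r.
have dsumr m (D : 'I_d.+1 -> 'I_d.+1 -> C) (c : C) (f : 'I_d.+1 -> A) :
    (forall k, D k m = c *+ (k == m)) -> \sum_k f k * (D k m)%:A = c *: f m.
  move=> De; rewrite (bigD1 m) //= De eqxx mulr1n mulr_algr big1 ?addr0 // => k km.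
  by rewrite De (negbTE km) mulr0n scale0r mulr0.
rewrite /P_ rhoK rhoKi mxE; under eq_bigr => k _ do rewrite !mxE.
rewrite (dsumr j _ (qpow (- wt d j)) (fun k => _)) => [|k]; last by rewrite sigmaKi.
rewrite mulrC -scalerA; congr (_ *: _).
rewrite big_ord_recl big_ord0 addr0 !mxE scalerAl; congr (_ * _).
under eq_bigr => k _ do rewrite !mxE.
rewrite (dsum i _ (qpow (wt d i)) (fun k => _)) // => k.
by rewrite sigmaK; case: eqVneq => [->|].
Qed.

Lemma sweedler_exists (z : uq_tens U) : exists s, sweedler z s.
Proof. exact: tens_span. Qed.

(** The matrix t sigma(K^-1) intertwines the twisted action on columns with
    the entrywise left action. It is invertible, so its inverse is an
    intertwiner too, without further computation in the Hopf algebra; psi is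
    one row of the matrix, and phi one column of its inverse. *)
Definition Psi (x : 'cV[A]_d.+1) : 'cV[A]_d.+1 :=
  \col_j \sum_(i < d.+1) qpow (- wt d i) *: (t d j i * x i 0).

Lemma Psi_inj : injective Psi.
Proof.
suff e (x : 'cV[A]_d.+1) i : x i 0 = qpow (wt d i) *: \sum_j ostar (t d j i) * Psi x j 0.
  by move=> x y xy; apply/matrixP => i j; rewrite (ord1 j) e xy -e.
under eq_bigr => j _ do rewrite mxE mulr_sumr.
rewrite exchange_big /= (bigD1 i) //= [X in _ + X]big1 => [|k ki].
  under eq_bigr => j _ do rewrite -scalerAr mulrA.
  rewrite -scaler_sumr -mulr_suml star_t_sum eqxx mul1r addr0 scalerA.
  by rewrite -qpowD // subrr qpow0 scale1r.
under eq_bigr => j _ do rewrite -scalerAr mulrA.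
by rewrite -scaler_sumr -mulr_suml star_t_sum eq_sym (negbTE ki) mul0r scaler0.
Qed.

Lemma Psi_phiA y j : Psi (phiA y) j 0 = y *+ (j == top).
Proof.
rewrite mxE; under eq_bigr => i _ do
  rewrite phiAE -scalerAr scalerA -qpowD // addNr qpow0 scale1r mulrA.
by rewrite -mulr_suml t_star_sum; case: eqP; rewrite ?mul1r ?mul0r.
Qed.

Lemma act_t n f (j k : 'I_n.+1) :
  act X f (t n j k) = \sum_i sigma X n f i k *: t n j i.
Proof.
rewrite t_vv // vvE linearZ /= sigmaP scaler_sumr; apply: eq_bigr => i _.
by rewrite -vvE scalerA mulrC -scalerA -t_vv.
Qed.

Lemma colactE f s (x : 'cV[A]_d.+1) i : sweedler (uDelta U f) s -> colact X f x i 0 =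
  \sum_(p <- s) \sum_k
    (qpow (wt d i) * sigma X d p.1 i k * qpow (- wt d k)) *: act X p.2 (x k 0).
Proof.
move=> sf; rewrite (colactP X x sf) summxE; apply: eq_bigr => p _.
rewrite !mxE; apply: eq_bigr => k _; rewrite !mxE mulr_algl; congr (_ *: _).
rewrite (bigD1 k) //= big1 ?addr0 => [|m mk]; last first.
  by rewrite sigmaKi (negbTE mk) mulr0.
rewrite sigmaKi eqxx !mxE (bigD1 i) //= big1 ?addr0 ?sigmaK ?eqxx // => m mi.
by rewrite sigmaK eq_sym (negbTE mi) mul0r.
Qed.

Lemma Psi_colact f (x : 'cV[A]_d.+1) : Psi (colact X f x) = map_mx (act X f) (Psi x).
Proof.
have [s sf] := sweedler_exists (uDelta U f).
apply/matrixP => j l; rewrite (ord1 l) !mxE linear_sum /=.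
under eq_bigr => i _ do rewrite (colactE _ _ sf) mulr_sumr scaler_sumr.
rewrite exchange_big /=.
under [RHS]eq_bigr => k _ do rewrite linearZ /= (act_mul X _ _ sf) scaler_sumr.
rewrite [RHS]exchange_big /=; apply: eq_bigr => p _.
under eq_bigr => i _ do rewrite mulr_sumr scaler_sumr.
rewrite exchange_big /=; apply: eq_bigr => k _.
rewrite act_t mulr_suml scaler_sumr; apply: eq_bigr => i _.
rewrite -scalerAr -[in RHS]scalerAl !scalerA; congr (_ *: _).
by rewrite !mulrA -qpowD // addNr qpow0 mul1r mulrC.
Qed.

Lemma phiA_act f y : colact X f (phiA y) = phiA (act X f y).
Proof.
apply: Psi_inj; apply/matrixP => j l; rewrite (ord1 l) Psi_colact mxE !Psi_phiA.
by rewrite linearMn.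
Qed.

End Projection.

(** * Kernel and range of partial_F on M_(N-1) *)

Section Ladder.
Context {R : realType}.
Variables (q : R).
Hypotheses (q_gt0 : 0 < q) (q_neq1 : q != 1).
Variables (U : UqSU2 q) (A : OSUq2 q) (W : peter_weyl A).
Variables (X : uq_actions U W) (H : gns_space W) (N : int).
Local Notation C := R[i].
Local Notation vv := (vbasis W).
Local Notation F := (uF U).
Local Notation ip := (ip H).
Local Notation M_ := (M_ X).
Local Notation d := (`|N|%N).

Definition kerdim : nat := if 0 < N then d else 0%N.
Definition cokerdim : nat := if N < 0 then d else 0%N.

(** In M_(N-1), partial_F cannot climb from the top weight j = l, which is
    (N-1)/2 only for 2l = N-1; in M_(N+1), it does not reach the lowest weight
    j = -l, which is (N+1)/2 only for 2l = -N-1. In both cases 2l = |N|-1. *)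
Definition kervec k : A := vv d.-1 d.-1 k.
Definition cokervec k : A := vv d.-1 0 k.

Lemma kerdim_gt0 (k : 'I_kerdim) : 0 < N /\ (k < d)%N.
Proof. by case: k => k /=; rewrite /kerdim; case: ifP. Qed.

Lemma cokerdim_gt0 (k : 'I_cokerdim) : N < 0 /\ (k < d)%N.
Proof. by case: k => k /=; rewrite /cokerdim; case: ifP. Qed.

Lemma M_kervec (k : 'I_kerdim) : M_ (N - 1) (kervec k).
Proof. by have [N0 _] := kerdim_gt0 k; apply: M_vv => //; lia. Qed.

Lemma M_cokervec (k : 'I_cokerdim) : M_ (N + 1) (cokervec k).
Proof. by have [N0 _] := cokerdim_gt0 k; apply: M_vv => //; lia. Qed.

Lemma pdF_kervec k : pd X F (kervec k) = 0.
Proof. by rewrite pdF_vv vv_out ?scaler0 // ltnn. Qed.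

Lemma kervec_orthonormal (k l : 'I_kerdim) : ip (kervec k) (kervec l) = (k == l)%:R.
Proof.
have [N0 kd] := kerdim_gt0 k; rewrite ip_vv !eqxx leqnn /= val_eqE.
suff -> : (k <= d.-1)%N by rewrite andbT.
by lia.
Qed.

Lemma cokervec_orthonormal (k l : 'I_cokerdim) :
  ip (cokervec k) (cokervec l) = (k == l)%:R.
Proof.
have [N0 kd] := cokerdim_gt0 k; rewrite ip_vv !eqxx /= val_eqE.
suff -> : (k <= d.-1)%N by rewrite andbT.
by lia.
Qed.

(** Away from the kernel every coefficient is multiplied by some alpha, and
    alpha >= 1. *)
Lemma pdF_bound x : M_ (N - 1) x -> (forall k : 'I_kerdim, ip x (kervec k) = 0) ->
  ip x x <= ip (pd X F x) (pd X F x).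
Proof.
move=> xM x0; have [b /(_ b (leqnn b)) ex] := expansion q_gt0 q_neq1 H x.
have fo (p p' : box b) : ip (pd X F (bv W p)) (pd X F (bv W p')) = (p == p')%:R *
    ((alpha q (spin p.1.1) (wt p.1.1 p.1.2))%:C ^+ 2
     * ((p.1.2 < p.1.1)%N && (p.2 <= p.1.1)%N)%:R).
  rewrite !pdF_vv ipZl ipZr rmorphN /= conjC_real !mulrA mulrNN.
  have [<-|pp'] := eqVneq p p'; first by rewrite -expr2 ip_vv !eqxx mul1r.
  rewrite !mul0r ip_vv; move: pp'; case: p p' => [[n j] k] [[n' j'] k'] /=.
  rewrite -!pair_eqE /= /pair_eq /= -!pair_eqE /= -!val_eqE /= eqSS => pp'.
  by case: and5P => [[e1 e2 e3]|]; [move: pp'; rewrite e1 e2 e3|rewrite mulr0].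
rewrite [in leRHS]ex linear_sum /=.
under [in leRHS]eq_bigr => p _ do rewrite linearZ /=.
rewrite [in leLHS]ex (ip_orthogonal_sum _ (@ip_bv _ _ _ _ H b)).
rewrite (ip_orthogonal_sum _ fo); apply: ler_sum => p _.
have [->|c0] := eqVneq (ip x (bv W p)) 0; first by rewrite normr0 expr0n !mul0r.
rewrite ler_wpM2l ?exprn_ge0 //.
have /andP[jn kn] : (p.1.2 <= p.1.1)%N && (p.2 <= p.1.1)%N.
  by apply: contraR c0 => /vv_out e; rewrite /bv e ip0r.
have wp : p.1.2%:Z * 2 - p.1.1%:Z = N - 1.
  by apply/eqP; apply: contraR c0 => /(M_P q_gt0 q_neq1 X H _ _).1 ->.
have jn' : (p.1.2 < p.1.1)%N.
  rewrite ltn_neqAle jn andbT; apply: contra c0 => /eqP e.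
  have kd : (p.2 < kerdim)%N by rewrite /kerdim; case: ifP; lia.
  have := x0 (Ordinal kd); rewrite /kervec /bv /= e.
  by have -> : d.-1 = p.1.1 by [lia|] => ->.
rewrite jn jn' kn mulr1 -[leLHS](expr1n _ 2) lerXn2r ?nnegrE ?ler0n ?ler0c //.
  by rewrite (le_trans ler01) // alpha_ge1.
by rewrite (_ : 1 = 1%:C) // lecR alpha_ge1.
Qed.

(** Termwise: v_(n,j+1,k) is the image of - alpha^-1 v_(n,j,k). *)
Lemma pdF_solve z : M_ (N + 1) z ->
  (forall k : 'I_cokerdim, ip z (cokervec k) = 0) -> exists y,
  [/\ M_ (N - 1) y, forall k : 'I_kerdim, ip y (kervec k) = 0 & pd X F y = z].
Proof.
move=> zM z0; have [b /(_ b (leqnn b)) ez] := expansion q_gt0 q_neq1 H z.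
have /fin_all_exists [y yP] (p : box b) : exists y, [/\ M_ (N - 1) y,
    forall k : 'I_kerdim, ip y (kervec k) = 0 &
    pd X F y = ip z (bv W p) *: bv W p].
  have [->|c0] := eqVneq (ip z (bv W p)) 0.
    exists 0; rewrite linear0 scale0r; split=> // [|k]; first exact: M_0.
    by rewrite ip0l.
  have /andP[jn kn] : (p.1.2 <= p.1.1)%N && (p.2 <= p.1.1)%N.
    by apply: contraR c0 => /vv_out e; rewrite /bv e ip0r.
  have wp : p.1.2%:Z * 2 - p.1.1%:Z = N + 1.
    by apply/eqP; apply: contraR c0 => /(M_P q_gt0 q_neq1 X H _ _).1 ->.
  case: p c0 jn kn wp => [[[n nb] [j jb]] [k kb]]; rewrite /bv /=.
  case: j jb => [|j] jb c0 jn kn wp.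
    have kd : (k < cokerdim)%N by rewrite /cokerdim; case: ifP; lia.
    have := z0 (Ordinal kd); rewrite /cokervec /=.
    have -> : d.-1 = n by lia.
    by move=> e; rewrite e eqxx in c0.
  have a0 : (alpha q (spin n) (wt n j))%:C != 0.
    by rewrite fmorph_eq0 gt_eqF // (lt_le_trans ltr01) // alpha_ge1.
  exists ((- ip z (vv n j.+1 k) / (alpha q (spin n) (wt n j))%:C) *: vv n j k).
  split=> [|l|].
  - by apply: M_Z => //; apply: M_vv => //; lia.
  - rewrite ipZl ip_vv; case: and5P => [[/eqP e1 /eqP e2]|]; last by rewrite mulr0.
    by move: jn; rewrite e1 e2 ltnn.
  - by rewrite linearZ /= pdF_vv scalerA mulrN divfK // opprK.
exists (\sum_p y p); split=> [|k|].
- by apply: M_sum => // p _; have [] := yP p.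
- by rewrite ip_suml big1 // => p _; have [_ ->] := yP p.
- by rewrite linear_sum /= [RHS]ez; apply: eq_bigr => p _; have [_ _ ->] := yP p.
Qed.

End Ladder.

(** * Closures in normed spaces *)

Section Closures.
Context {K : numFieldType}.

Lemma closure_map (S T : topologicalType) (f : S -> T) (P : set S) (Q : set T) :
  continuous f -> (forall x, P x -> closure Q (f x)) ->
  forall x, closure P x -> closure Q (f x).
Proof.
move=> cf PQ; rewrite [closure P]closureE; apply: smallest_sub => //.
by apply: (continuous_closedP f).1 => //; apply: closed_closure.
Qed.

Lemma closure_closure (T : topologicalType) (S : set T) : closure (closure S) = closure S.
Proof. by apply/esym/closure_id; apply: closed_closure. Qed.

Lemma closure_linear (V : normedModType K) (S : set V) :
  (forall c x y, S x -> S y -> S (c *: x + y)) ->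
  forall c x y, closure S x -> closure S y -> closure S (c *: x + y).
Proof.
move=> Slin c x y xS yS; rewrite -closure_closure.
have cZD (z : V) : continuous (fun x : V => c *: x + z).
  by move=> u; apply: cvgD; [apply: scaler_continuous|apply: cvg_cst].
have cD (z : V) : continuous (fun y : V => z + y).
  by move=> u; apply: cvgD; [apply: cvg_cst|apply: cvg_id].
apply: (closure_map (cZD y) _ xS) => {x xS} x xS; rewrite closure_closure.
apply: (closure_map (cD (c *: x)) _ yS) => {y yS} y yS.
by apply: subset_closure; apply: Slin.
Qed.

Lemma closureP (V : normedModType K) (S : set V) x :
  closure S x <-> forall e, 0 < e -> exists y, S y /\ `|x - y| < e.
Proof.
split=> [xS e e0|xS B /nbhs_normP [e /= e0 eB]].
  have [y [Sy /= xy]] := xS _ (nbhsx_ballx x _ e0); exists y; split => //.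
  by rewrite -ball_normE in xy.
by have [y [Sy xy]] := xS e e0; exists y; split => //; apply: eB.
Qed.

Lemma closure_pairP (U V : normedModType K) (S : set (U * V)) x y :
  closure S (x, y) <->
  forall e, 0 < e -> exists p, [/\ S p, `|x - p.1| < e & `|y - p.2| < e].
Proof.
have maxE (u : U) (v : V) e : `|(u, v) : ((U * V)%type : normedModType K)| < e <-> `|u| < e /\ `|v| < e.
  rewrite prod_normE /= comparable_gt_max ?real_comparable ?normr_real //.
  by split=> /andP.
split=> [/closureP xS e /xS [p [Sp /maxE [? ?]]]|xS]; first by exists p.
by apply/closureP => e /xS [p [Sp ? ?]]; exists p; split => //; apply/maxE.
Qed.

Lemma continuous_bound (U V : normedModType K) (f : U -> V) :
  linear f -> continuous f -> exists2 c, 0 < c & forall x, `|f x| <= c * `|x|.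
Proof.
move=> lf cf; pose L := HB.pack_for {linear U -> V} f (GRing.isLinear.Build _ _ _ _ f lf).
have /linear_boundedP bf : bounded_near L (nbhs 0).
  exact/linear_bounded_continuous.
have [c c0 fc] := pinfty_ex_gt0 bf.
by exists c.
Qed.

(** Closed range theorem in the form needed here: the vectors x of S with g x
    close to z have f x close to each other, so f x converges as g x tends to
    z, by completeness. *)
Lemma complete_preimage (A : lmodType K) (V : completeNormedModType K)
    (f g : {linear A -> V}) (S : set A) c z :
  0 <= c ->
  (forall x y, S x -> S y -> S (x - y)) ->
  (forall x, S x -> `|f x| <= c * `|g x|) ->
  closure (g @` S) z -> exists y, closure [set (f x, g x) | x in S] (y, z).
Proof.
move=> c0 SB fg zS.
(* The filter on A of the vectors of S whose image under g approaches z. *)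
pose B (O : set V) := S `&` g @^-1` O.
pose G := filter_from (nbhs z) B.
have GF : Filter G.
  apply: filter_from_filter; first by exists setT; apply: filterT.
  move=> O O' nO nO'; exists (O `&` O'); first exact: filterI.
  by move=> x [Sx [Ox Ox']].
have GP : ProperFilter G.
  apply: filter_from_proper => // O nO; have [_ [[x Sx <-] Ogx]] := zS _ nO.
  by exists x.
have /cauchy_exP /cauchy_cvg fG : cauchy_ex (f @ G).
  move=> e e0; pose e1 := e / 2 / (c + 1).
  have c1 : 0 < c + 1 by rewrite ltr_wpDl.
  have e10 : 0 < e1 by rewrite !divr_gt0.
  have [_ [[x0 Sx0 <-] zx0]] := zS _ (nbhsx_ballx z _ e10).
  exists (f x0); exists (ball z e1); first exact: nbhsx_ballx.
  move=> x [Sx zx]; rewrite -ball_normE /= -linearB.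
  apply: (le_lt_trans (fg _ (SB _ _ Sx0 Sx))).
  have : `|g x0 - g x| < e1 + e1.
    move: zx0 zx; rewrite -ball_normE /= => zx0 zx.
    have -> : g x0 - g x = (z - g x) - (z - g x0) by rewrite opprB [RHS]addrC addrA subrK.
    by rewrite (le_lt_trans (ler_normB _ _)) // ltrD.
  rewrite -linearB => /ltW gx; apply: (le_lt_trans (ler_wpM2l c0 gx)).
  rewrite -mulrDl -splitr mulrCA -[ltRHS]mulr1 ltr_pM2l // ltr_pdivrMr // mul1r.
  by rewrite ltrDl.
have [y fy] : exists y : V, f @ G --> y by exists (lim (f @ G)).
exists y; apply/closure_pairP => e e0.
have /fy : nbhs y (ball y e) by apply: nbhsx_ballx.
have : G (B (ball z e)) by exists (ball z e) => //; apply: nbhsx_ballx.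
move=> GB Gf; have [x [[Sx gx] fx]] := filter_ex (filterI GB Gf).
exists (f x, g x); split; first by exists x.
  by rewrite -ball_normE in fx.
by rewrite -ball_normE in gx.
Qed.

Lemma ptws_cvg (n : nat) (V : uniformType) (F : set_system ('I_n -> V)) f :
  Filter F -> (forall i, g i @[g --> F] --> f i) -> F --> (f : {ptws 'I_n -> V}).
Proof.
(* pointwise_cvgP is stated for topological spaces of indices. *)
move=> FF h; exact: ((@pointwise_cvgP (discrete_topology 'I_n) V F f FF).2 h).
Qed.

End Closures.

(** * The GNS space *)

Section GnsSpace.
Context {R : realType}.
Variables (q : R).
Variables (A : OSUq2 q) (W : peter_weyl A) (H : gns_space W).
Local Notation C := R[i].
Local Notation emb := (gns_emb H).
Local Notation dot := (gns_dot H).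
Local Notation lmul := (@gns_lmul _ _ _ _ H).
Local Notation ip := (ip H).

Lemma normr_emb x : `|emb x| ^+ 2 = ip x x.
Proof. exact: gns_norm. Qed.

Lemma dotC x y : dot x y = (dot y x)^*.
Proof. by rewrite hermC mul1r. Qed.

(** Cauchy-Schwarz, from the positivity of the squared norm of n x - a y, where
    n = |y|^2 and a is the scalar product of x and y. *)
Lemma dot_bound x y : `|dot x y| <= `|x| * `|y|.
Proof.
have [->|y0] := eqVneq y 0; first by rewrite linear0r normr0 mulr_ge0.
have ny : 0 < `|y| by rewrite normr_gt0.
rewrite -(@ler_pXn2r _ 2) ?nnegrE ?mulr_ge0 // exprMn.
set a := dot x y; pose n := `|y| ^+ 2.
have n0 : 0 < n by rewrite exprn_gt0.
have d_n : dot (n *: x) (a *: y) = n * `|a| ^+ 2.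
  by rewrite linearZl_LR linearZr_LR /= -/a -normCKC.
have cn : (n * `|a| ^+ 2)^* = n * `|a| ^+ 2.
  by rewrite conj_Creal // realM // ger0_real // exprn_ge0.
have := dnorm_ge0 dot (n *: x - a *: y).
rewrite dnormB d_n cn !dnormZ -!gns_norm -/n (ger0_norm (ltW n0)).
have -> : n ^+ 2 * `|x| ^+ 2 + `|a| ^+ 2 * n - (n * `|a| ^+ 2 + n * `|a| ^+ 2) =
  n * (`|x| ^+ 2 * n - `|a| ^+ 2) by ring.
by rewrite pmulr_rge0 // subr_ge0.
Qed.

Lemma orth_closure (S : set H) w : (forall x, S x -> dot x w = 0) ->
  forall x, closure S x -> dot x w = 0.
Proof.
move=> S0 x /closureP xS; apply/eqP; rewrite -normr_le0.
have w1 : 0 < `|w| + 1 by rewrite ltr_wpDl.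
apply/negP => /negP; rewrite -real_ltNge ?normr_real ?real0 // => xw.
have [y [Sy xy]] := xS _ (divr_gt0 xw w1).
have : `|dot x w| < `|dot x w|.
  rewrite -{1}[dot x w]subr0 -(S0 _ Sy) -linearBl.
  apply: le_lt_trans (dot_bound _ _) _; move: xy; rewrite ltr_pdivlMr //.
  by apply: le_lt_trans; rewrite ler_wpM2l // lerDl.
by rewrite ltxx.
Qed.

Lemma graph_adjoint (S : set (H * H)) w w' :
  (forall p, S p -> dot p.2 w = dot p.1 w') ->
  forall p, closure S p -> dot p.2 w = dot p.1 w'.
Proof.
move=> S0 [x y] /closure_pairP xS; apply/eqP; rewrite -subr_eq0 -normr_le0.
have w1 : 0 < `|w| + `|w'| + 1 by rewrite ltr_wpDl ?addr_ge0.
apply/negP => /negP; rewrite -real_ltNge ?normr_real ?real0 //= => xw.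
have [[a b] /= [Sab xa yb]] := xS _ (divr_gt0 xw w1).
have : `|dot y w - dot x w'| < `|dot y w - dot x w'|.
  have {1}-> : dot y w - dot x w' = dot (y - b) w - dot (x - a) w'.
    by rewrite !linearBl; have /= -> := S0 _ Sab; rewrite opprB addrA subrK.
  apply: le_lt_trans (ler_normB _ _) _.
  apply: le_lt_trans (lerD (dot_bound _ _) (dot_bound _ _)) _.
  move: xa yb; set e := _ / _ => /ltW xa /ltW yb.
  apply: le_lt_trans (lerD (ler_wpM2r _ yb) (ler_wpM2r _ xa)) _ => //.
  rewrite -mulrDr /e mulrAC ltr_pdivrMr // ltr_pM2l // ltrDl //.
by rewrite ltxx.
Qed.

Lemma dense_orth x : (forall a, dot x (emb a) = 0) -> x = 0.
Proof.
move=> x0; apply/eqP; rewrite -(dnorm_eq0 dot); apply/eqP.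
have : closure (range emb) x by rewrite gns_dense.
by apply: orth_closure => _ [a _ <-]; rewrite dotC x0 conjC0.
Qed.

(** All algebraic properties of the continuous operators lmul a are checked on
    the dense subspace emb A, one argument at a time. *)
Lemma dense_eq (V : normedModType C) (f g : H -> V) : continuous f -> continuous g ->
  (forall a, f (emb a) = g (emb a)) -> forall x, f x = g x.
Proof.
move=> cf cg fg x; apply/eqP; rewrite -subr_eq0; apply/eqP.
have e0 : closure [set (0 : V)] = [set 0].
  by apply/esym/closure_id; apply: accessible_closed_set1; apply: hausdorff_accessible.
suff : closure [set (0 : V)] (f x - g x) by rewrite e0.
apply: (closure_map (f := fun x => f x - g x) (P := range emb)).
- by move=> y; apply: cvgB; [apply: cf|apply: cg].
- by move=> _ [a _ <-]; apply: subset_closure; rewrite fg subrr.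
- by rewrite gns_dense.
Qed.

Lemma lmulD a x y : lmul a (x + y) = lmul a x + lmul a y.
Proof.
move: x; apply: dense_eq.
- move=> x; apply: (@continuous_comp _ _ _ (fun x => x + y)); last exact: gns_lmul_cont.
  by apply: cvgD; [apply: cvg_id|apply: cvg_cst].
- by move=> x; apply: cvgD; [apply: gns_lmul_cont|apply: cvg_cst].
move=> b; move: y; apply: dense_eq.
- move=> x; apply: (@continuous_comp _ _ _ (fun x => emb b + x)); last exact: gns_lmul_cont.
  by apply: cvgD; [apply: cvg_cst|apply: cvg_id].
- by move=> x; apply: cvgD; [apply: cvg_cst|apply: gns_lmul_cont].
by move=> c; rewrite -linearD !gns_lmulP mulrDr linearD.
Qed.

Lemma lmulZ a c x : lmul a (c *: x) = c *: lmul a x.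
Proof.
move: x; apply: dense_eq.
- move=> x; apply: (@continuous_comp _ _ _ (fun x => c *: x)); last exact: gns_lmul_cont.
  exact: scaler_continuous.
- move=> x; apply: (@continuous_comp _ _ _ _ (fun x => c *: x)); first exact: gns_lmul_cont.
  exact: scaler_continuous.
by move=> b; rewrite -linearZ !gns_lmulP -scalerAr linearZ.
Qed.

Fact lmul_is_linear a : linear (lmul a).
Proof. by move=> c x y; rewrite lmulD lmulZ. Qed.
HB.instance Definition _ a :=
  GRing.isLinear.Build C H H *:%R (lmul a) (lmul_is_linear a).

Lemma lmulM a b x : lmul (a * b) x = lmul a (lmul b x).
Proof.
move: x; apply: dense_eq; first exact: gns_lmul_cont.
  by move=> x; apply: continuous_comp; exact: gns_lmul_cont.
by move=> c; rewrite !gns_lmulP mulrA.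
Qed.

Lemma lmulZDl c a b x : lmul (c *: a + b) x = c *: lmul a x + lmul b x.
Proof.
move: x; apply: dense_eq; first exact: gns_lmul_cont.
  move=> x; apply: cvgD; last exact: gns_lmul_cont.
  apply: (@continuous_comp _ _ _ _ (fun x => c *: x)); first exact: gns_lmul_cont.
  exact: scaler_continuous.
by move=> y; rewrite !gns_lmulP mulrDl -scalerAl linearP.
Qed.

Lemma lmul1 x : lmul 1 x = x.
Proof.
move: x; apply: dense_eq; first exact: gns_lmul_cont.
  by move=> x; apply: cvg_id.
by move=> y; rewrite gns_lmulP mul1r.
Qed.

Lemma lmul0l x : lmul 0 x = 0.
Proof. by have := lmulZDl (- 1) 1 1 x; rewrite scaleN1r addNr => ->; rewrite scaleN1r addNr. Qed.

Lemma lmulDl a b x : lmul (a + b) x = lmul a x + lmul b x.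
Proof. by rewrite -{1}[a]scale1r lmulZDl scale1r. Qed.

Lemma lmulZl c a x : lmul (c *: a) x = c *: lmul a x.
Proof. by rewrite -[_ *: _]addr0 lmulZDl lmul0l addr0. Qed.

Lemma lmul_suml (I : Type) (s : seq I) P (f : I -> A) x :
  lmul (\sum_(i <- s | P i) f i) x = \sum_(i <- s | P i) lmul (f i) x.
Proof.
by rewrite (big_morph (fun a => lmul a x) (fun a b => lmulDl a b x) (lmul0l x)).
Qed.

Lemma ip_mul_star a x y : ip (a * x) y = ip x (ostar a * y).
Proof.
by rewrite !ip_haar (star_mul (ostarP A)) (star_inv (ostarP A)) mulrA.
Qed.

Lemma dot_lmul a x y : dot (lmul a x) y = dot x (lmul (ostar a) y).
Proof.
have h1 c z b : dot (lmul c z) (emb b) = dot z (emb (ostar c * b)).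
  pose S := [set (emb u, emb (c * u)) | u in setT].
  apply: (@graph_adjoint S _ _ _ (z, lmul c z)) => [_ [u _ <-] /=|].
    by rewrite -!/(ip _ _) ip_mul_star.
  apply: (closure_map (f := fun z => (z, lmul c z)) (P := range emb)).
  - by move=> u; apply: cvg_pair; [apply: cvg_id|apply: gns_lmul_cont].
  - by move=> _ [u _ <-]; apply: subset_closure; exists u => //; rewrite gns_lmulP.
  - by rewrite gns_dense.
pose S := [set (emb (ostar a * u), emb u) | u in setT].
rewrite dotC [RHS]dotC; congr (_^* ).
apply: (@graph_adjoint S _ _ _ (lmul (ostar a) y, y)) => [_ [u _ <-] /=|].
  by rewrite dotC h1 -dotC.
apply: (closure_map (f := fun z => (lmul (ostar a) z, z)) (P := range emb)).
- by move=> u; apply: cvg_pair; [apply: gns_lmul_cont|apply: cvg_id].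
- by move=> _ [u _ <-]; apply: subset_closure; exists u => //; rewrite gns_lmulP.
- by rewrite gns_dense.
Qed.

Definition orthpart n (u : 'I_n -> A) (x : H) : H :=
  x - \sum_k dot x (emb (u k)) *: emb (u k).

Definition orthpartA n (u : 'I_n -> A) (x : A) : A :=
  x - \sum_k ip x (u k) *: u k.

Lemma orthpart_emb n (u : 'I_n -> A) x : orthpart u (emb x) = emb (orthpartA u x).
Proof.
by rewrite /orthpartA linearB linear_sum; congr (_ - _); apply: eq_bigr => k _; rewrite linearZ.
Qed.

Lemma orthpart_continuous n (u : 'I_n -> A) : continuous (orthpart u).
Proof.
have rank1 v : continuous (fun x => dot x v *: v).
  have lin : linear (fun x => dot x v *: v).
    by move=> c x y; rewrite linearDl linearZl_LR scalerDl scalerA.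
  pose L := HB.pack_for {linear H -> H} (fun x => dot x v *: v)
    (GRing.isLinear.Build _ _ _ _ _ lin).
  apply: (@bounded_linear_continuous _ _ _ L); apply/linear_boundedP.
  near=> r => x; rewrite /= normrZ.
  apply: (@le_trans _ _ (`|x| * `|v| * `|v|)).
    by rewrite ler_wpM2r // dot_bound.
  rewrite -mulrA mulrC ler_wpM2r //; near: r; apply: nbhs_pinfty_ge.
  by rewrite realM ?normr_real.
move=> x; apply: cvgB; first exact: cvg_id.
apply: cvg_big => [|k _]; [exact: add_continuous|exact: rank1].
Unshelve. all: by end_near. Qed.

Lemma dot_orthpart n (u : 'I_n -> A) x k :
  (forall i j, ip (u i) (u j) = (i == j)%:R) -> dot (orthpart u x) (emb (u k)) = 0.
Proof.
move=> uo; rewrite /orthpart linearBl linear_sumlz /= (bigD1 k) //= big1.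
  by rewrite linearZl_LR /= -/(ip _ _) uo eqxx mulr1 addr0 subrr.
by move=> j jk; rewrite linearZl_LR /= -/(ip _ _) uo (negbTE jk) mulr0.
Qed.

Lemma ip_orthpart n (u : 'I_n -> A) x k :
  (forall i j, ip (u i) (u j) = (i == j)%:R) -> ip (orthpartA u x) (u k) = 0.
Proof. by move=> uo; rewrite /ip -orthpart_emb dot_orthpart. Qed.

End GnsSpace.

(** * The closure of partial_F *)

Section ClosedLadder.
Context {R : realType}.
Variables (q : R).
Hypotheses (q_gt0 : 0 < q) (q_neq1 : q != 1).
Variables (U : UqSU2 q) (A : OSUq2 q) (W : peter_weyl A).
Variables (X : uq_actions U W) (H : gns_space W).
Local Notation C := R[i].
Local Notation emb := (gns_emb H).
Local Notation dot := (gns_dot H).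
Local Notation lmul := (@gns_lmul _ _ _ _ H).
Local Notation ip := (ip H).
Local Notation M_ := (M_ X).
Local Notation Mbar := (Mbar X H).
Local Notation F := (uF U).

(** At m = - 1 this is the entry of the Dirac operator; P_N leads to the other
    values of m. *)
Definition Dgraph (m : int) : set (H * H) :=
  closure [set p : H * H | exists2 x, M_ m x & p = (emb x, emb (pd X F x))].

Lemma Mbar_emb m x : M_ m x -> Mbar m (emb x).
Proof. by move=> xm; apply: subset_closure; exists x. Qed.

Lemma Mbar_lin m c x y : Mbar m x -> Mbar m y -> Mbar m (c *: x + y).
Proof.
apply: closure_linear => {}c _ _ [x' xm <-] [y' ym <-]; exists (c *: x' + y').
  exact: M_lin.
by rewrite linearP.
Qed.

Lemma Mbar_0 m : Mbar m 0.
Proof. by rewrite -(linear0 emb); apply: Mbar_emb; apply: M_0. Qed.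

Lemma Mbar_D m x y : Mbar m x -> Mbar m y -> Mbar m (x + y).
Proof. by move=> xm ym; rewrite -[x]scale1r; apply: Mbar_lin. Qed.

Lemma Mbar_Z m c x : Mbar m x -> Mbar m (c *: x).
Proof. by move=> xm; rewrite -[_ *: _]addr0; apply: Mbar_lin => //; apply: Mbar_0. Qed.

Lemma Mbar_sum m (I : Type) (s : seq I) (P : pred I) (f : I -> H) :
  (forall i, P i -> Mbar m (f i)) -> Mbar m (\sum_(i <- s | P i) f i).
Proof.
by move=> fm; apply: big_ind => //; [apply: Mbar_0|apply: Mbar_D].
Qed.

Lemma Mbar_lmul m m' a x : M_ m a -> Mbar m' x -> Mbar (m + m') (lmul a x).
Proof.
move=> am; apply: closure_map; first exact: gns_lmul_cont.
move=> _ [y ym <-]; apply: subset_closure; exists (a * y); first exact: M_mul.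
by rewrite gns_lmulP.
Qed.

(** Fourier coefficients are continuous, so they still detect M_m after
    completion. *)
Lemma emb_Mbar m x : Mbar m (emb x) -> M_ m x.
Proof.
move=> xm; apply/(M_P q_gt0 q_neq1 X H) => n j k jm; rewrite /ip.
apply: orth_closure xm => _ [y ym <-].
by move: ym => /(M_P q_gt0 q_neq1 X H m y).1 h; apply: h.
Qed.

Lemma Dgraph_emb m x : M_ m x -> Dgraph m (emb x, emb (pd X F x)).
Proof. by move=> xm; apply: subset_closure; exists x. Qed.

Lemma Dgraph_lin m c p p' : Dgraph m p -> Dgraph m p' -> Dgraph m (c *: p + p').
Proof.
apply: closure_linear => {}c _ _ [x xm ->] [y ym ->]; exists (c *: x + y).
  exact: M_lin.
by rewrite !linearP.
Qed.

Lemma Dgraph_0 m : Dgraph m (0, 0).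
Proof.
have := Dgraph_emb (M_0 q_gt0 X m).
by rewrite !linear0.
Qed.

Lemma Dgraph_sum m (I : Type) (s : seq I) (f g : I -> H) :
  (forall i, Dgraph m (f i, g i)) ->
  Dgraph m (\sum_(i <- s) f i, \sum_(i <- s) g i).
Proof.
move=> fg; elim: s => [|i s IH]; first by rewrite !big_nil; apply: Dgraph_0.
by rewrite !big_cons; have := Dgraph_lin (c := 1) (fg i) IH; rewrite !scale1r.
Qed.

Lemma Dgraph_dom m p : Dgraph m p -> Mbar m p.1.
Proof.
apply: (closure_map (f := fst)); first by move=> x; apply: cvg_fst.
by move=> _ [x xm ->]; apply: Mbar_emb.
Qed.

Lemma Dgraph_ran m p : Dgraph m p -> Mbar (m + 2) p.2.
Proof.
apply: (closure_map (f := snd)); first by move=> x; apply: cvg_snd.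
by move=> _ [x xm ->]; apply: Mbar_emb; apply: M_pdF.
Qed.

Lemma Dgraph_adjoint m p w : Dgraph m p ->
  dot p.2 (emb w) = dot p.1 (emb (pd X (uE U) w)).
Proof.
move: p; apply: graph_adjoint => _ [x xm ->] /=.
exact: (pdF_adjoint q_gt0 q_neq1 X H x w).
Qed.

Lemma Dgraph_fun m x y y' : Dgraph m (x, y) -> Dgraph m (x, y') -> y = y'.
Proof.
move=> xy xy'; apply/eqP; rewrite -subr_eq0; apply/eqP/(dense_orth (H := H)) => w.
rewrite linearBl /=.
have /= -> := Dgraph_adjoint w xy; have /= -> := Dgraph_adjoint w xy'.
by rewrite subrr.
Qed.

Lemma M_orthpartA m n (u : 'I_n -> A) x : (forall k, M_ m (u k)) -> M_ m x ->
  M_ m (orthpartA H u x).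
Proof.
move=> um xm; rewrite /orthpartA [x - _]addrC -scaleN1r; apply: M_lin => //.
by apply: M_sum => // k _; apply: M_Z.
Qed.

Section Index.
Variable N : int.
Local Notation kervec := (kervec W N).
Local Notation cokervec := (cokervec W N).

Let ku (k : 'I_(kerdim N)) : A := kervec k.
Let cku (k : 'I_(cokerdim N)) : A := cokervec k.

Let V0 : set A :=
  [set x | M_ (N - 1) x /\ forall k : 'I_(kerdim N), ip x (kervec k) = 0].

Let V0_sub x y : V0 x -> V0 y -> V0 (x - y).
Proof.
move=> [xm x0] [ym y0]; split=> [|k].
  by rewrite [x - y]addrC -scaleN1r; apply: M_lin.
by rewrite [x - y]addrC -scaleN1r ipZDl x0 y0 mulr0 addr0.
Qed.

Let V0_bound x : V0 x -> `|emb x| <= 1 * `|(emb \o pd X F) x|.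
Proof.
move=> [xm x0]; rewrite mul1r -(@ler_pXn2r _ 2) ?nnegrE //= !normr_emb.
exact: (pdF_bound q_gt0 q_neq1 xm x0).
Qed.

(** Removing the kernel vectors maps the graph of partial_F into its graph over
    V0, where partial_F is bounded below; so a limit (y, 0) loses all of y. *)
Lemma Dgraph_ker y : Dgraph (N - 1) (y, 0) <->
  exists c : 'I_(kerdim N) -> C, y = \sum_k c k *: emb (kervec k).
Proof.
split=> [y0|[c ->]]; last first.
  have := @Dgraph_sum (N - 1) _ (index_enum 'I_(kerdim N))
    (fun k => c k *: emb (kervec k)) (fun=> 0).
  rewrite sumr_const mul0rn; apply=> k.
  have -> : (c k *: emb (kervec k), 0 : H) =
      c k *: (emb (kervec k), emb (pd X F (kervec k))) + (0, 0).
    rewrite pdF_kervec // (linear0 emb).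
    by apply: injective_projections; rewrite /= ?addr0 ?scaler0.
  by apply: Dgraph_lin (Dgraph_0 _); apply/Dgraph_emb/M_kervec.
move: y0; have h p : Dgraph (N - 1) p -> closure [set (emb x, (emb \o pd X F) x)
    | x in V0] (orthpart ku p.1, p.2).
  apply: (closure_map (f := fun p => (orthpart ku p.1, p.2))).
    move=> p0; apply: cvg_pair; last exact: cvg_snd.
    apply: (@continuous_comp _ _ _ fst); first by apply: cvg_fst.
    exact: orthpart_continuous.
  move=> _ [x xm ->] /=; apply: subset_closure; rewrite orthpart_emb.
  exists (orthpartA H ku x).
    split=> [|k]; first by apply: M_orthpartA => // k; apply: M_kervec.
    by apply: ip_orthpart; apply: kervec_orthonormal.
  congr pair; rewrite /= /orthpartA linearB /= linear_sum big1 ?subr0 // => k _.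
  by rewrite linearZ /= pdF_kervec // scaler0.
move=> /h /closure_pairP y1.
suff : orthpart ku y = 0.
  by move/eqP; rewrite subr_eq0 => /eqP e; exists (fun k => dot y (emb (kervec k))).
apply/eqP; rewrite -normr_le0; apply/negP => /negP.
rewrite -real_ltNge ?normr_real ?real0 // => yn.
have [_ [[x Vx <-] /= yx x0]] := y1 _ (divr_gt0 yn (ltr0n _ 2)).
have : `|orthpart ku y| < `|orthpart ku y|.
  rewrite -{1}[orthpart _ _](subrK (emb x)) (le_lt_trans (ler_normD _ _)) //.
  rewrite [ltRHS]splitr ltr_leD // (le_trans (V0_bound Vx)) // mul1r /=.
  by rewrite -normrN -sub0r ltW.
by rewrite ltxx.
Qed.

(** Elements z of the closure which are orthogonal to the cokernel vectors are
    limits of algebraic ones, and these have preimages in V0; the bound below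
    on V0 makes the preimages converge. *)
Lemma Dgraph_range z : (exists y, Dgraph (N - 1) (y, z)) <->
  Mbar (N + 1) z /\ forall k : 'I_(cokerdim N), dot z (emb (cokervec k)) = 0.
Proof.
split=> [[y yz]|[zm z0]].
  split=> [|k].
    by move: (Dgraph_ran yz) => /=; rewrite -addrA.
  have /= -> := Dgraph_adjoint (cokervec k) yz.
  by rewrite /cokervec pdE_vv0 linear0 linear0r.
have zV : closure ((emb \o pd X F) @` V0) z.
  have -> : z = orthpart cku z.
    by rewrite /orthpart big1 ?subr0 // => k _; rewrite z0 scale0r.
  apply: closure_map zm; first exact: orthpart_continuous.
  move=> _ [x xm <-]; rewrite orthpart_emb; apply: subset_closure.
  set x' := orthpartA _ _ _.
  have x'm : M_ (N + 1) x' by apply: M_orthpartA => // k; apply: M_cokervec.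
  have x'0 (k : 'I_(cokerdim N)) : ip x' (cokervec k) = 0.
    by apply: ip_orthpart; apply: cokervec_orthonormal.
  have [y [ym y0 yx]] := pdF_solve q_gt0 q_neq1 x'm x'0.
  by exists y => //=; rewrite yx.
have [y yz] := complete_preimage ler01 V0_sub V0_bound zV.
exists y; apply: closureS yz => _ [x [xm _] <-].
by exists x.
Qed.

End Index.

End ClosedLadder.

Arguments Dgraph {R q U A W} X H m _.

(** * Trivializing the projective modules *)

Section Transport.
Context {R : realType}.
Variables (q : R).
Hypotheses (q_gt0 : 0 < q) (q_neq1 : q != 1).
Variables (U : UqSU2 q) (A : OSUq2 q) (W : peter_weyl A).
Variables (X : uq_actions U W) (H : gns_space W) (N : int).
Local Notation C := R[i].
Local Notation emb := (gns_emb H).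
Local Notation dot := (gns_dot H).
Local Notation lmul := (@gns_lmul _ _ _ _ H).
Local Notation qpow := (qpow q).
Local Notation M_ := (M_ X).
Local Notation Mbar := (Mbar X H).
Local Notation PMbar := (PMbar X H N).
Local Notation PdFP := (PdFP X H N).
Local Notation Dgraph := (Dgraph X H).
Local Notation F := (uF U).
Local Notation half m := (m%:~R / 2 : R).
Local Notation d := (`|N|%N).
Local Notation tN := (tN W (N := N)).
Local Notation tS := (tS W (N := N)).
Local Notation col := ('I_d.+1 -> H).

(** The completions of phiA and psiA: phi identifies Mbar_(k+N) with
    P_N Mbar_k^(|N|+1), with inverse psi. *)
Definition phi (y : H) : col := fun i => qpow (wt d i) *: lmul (tS i) y.
Definition psi (x : col) : H := \sum_(i < d.+1) qpow (- wt d i) *: lmul (tN i) (x i).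

Lemma phi_emb y : phi (emb y) = embcol H (phiA W N y).
Proof.
by apply/funext => i; rewrite /phi /embcol phiAE gns_lmulP linearZ.
Qed.

Lemma psi_embcol x : psi (embcol H x) = emb (psiA W x).
Proof.
rewrite /psi /psiA linear_sum; apply: eq_bigr => i _.
by rewrite linearZ /= /embcol gns_lmulP.
Qed.

Lemma phiK y : psi (phi y) = y.
Proof.
rewrite -[RHS](lmul1 (H := H)) -(tN_tS W N) lmul_suml; apply: eq_bigr => i _.
by rewrite /phi linearZ /= scalerA -qpowD // addNr qpow0 scale1r lmulM.
Qed.

Lemma phi_inj : injective phi. Proof. exact: can_inj phiK. Qed.

Lemma phi_linear c x y : phi (c *: x + y) = c *: phi x + phi y.
Proof.
apply/funext => i; rewrite /phi linearP scalerDr !scalerA mulrC -scalerA.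
by [].
Qed.

Lemma phi0 : phi 0 = 0.
Proof. by apply/funext => i; rewrite /phi linear0 scaler0. Qed.

Lemma phiZ c x : phi (c *: x) = c *: phi x.
Proof. by rewrite -[_ *: x]addr0 phi_linear phi0 addr0. Qed.

Lemma phi_sum (I : Type) (s : seq I) (c : I -> C) (f : I -> H) :
  phi (\sum_(i <- s) c i *: f i) = \sum_(i <- s) c i *: phi (f i).
Proof.
elim: s => [|i s IH]; first by rewrite !big_nil phi0.
by rewrite !big_cons phi_linear IH.
Qed.

Lemma psiZ c x : psi (fun i => c *: x i) = c *: psi x.
Proof.
rewrite /psi scaler_sumr; apply: eq_bigr => i _.
by rewrite linearZ /= !scalerA mulrC.
Qed.

Lemma psiD x y : psi (fun i => x i + y i) = psi x + psi y.
Proof.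
by rewrite /psi -big_split; apply: eq_bigr => i _; rewrite lmulD scalerDr.
Qed.

Lemma phi_continuous : continuous (phi : H -> {ptws 'I_d.+1 -> H}).
Proof.
move=> y; apply: ptws_cvg => i.
apply: (@continuous_comp _ _ _ (lmul (tS i)) (fun x => qpow (wt d i) *: x)).
  exact: gns_lmul_cont.
exact: scaler_continuous.
Qed.

Lemma mulcolE x : mulcol H (P_ X N) x = phi (psi x).
Proof.
apply/funext => i; rewrite /mulcol /phi /psi linear_sum scaler_sumr.
apply: eq_bigr => j _; rewrite P_E // lmulZl lmulM linearZ /=.
by rewrite scalerA.
Qed.

Lemma Mbar_phi m y i : Mbar m y -> Mbar (m - N) (phi y i).
Proof.
move=> ym; apply: Mbar_Z => //; rewrite addrC.
by apply: Mbar_lmul => //; apply: M_tS.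
Qed.

Lemma Mbar_psi m x : (forall i, Mbar m (x i)) -> Mbar (m + N) (psi x).
Proof.
move=> xm; apply: Mbar_sum => // i _; apply: Mbar_Z => //; rewrite addrC.
by apply: Mbar_lmul => //; apply: M_tN.
Qed.

Lemma PMbarE k x : PMbar k x <-> exists2 y, Mbar (k + N) y & x = phi y.
Proof.
split=> [[z zk <-]|[y yk ->]].
  by exists (psi z); rewrite ?mulcolE //; apply: Mbar_psi.
exists (phi y); last by rewrite mulcolE phiK.
by move=> i; have := Mbar_phi (i := i) yk; rewrite addrK.
Qed.

Let continuousZ (g : H * H -> H) c : continuous g -> continuous (fun p => c *: g p).
Proof.
move=> cg u; apply: (@continuous_comp _ _ _ g (fun x => c *: x)); first exact: cg.
exact: scaler_continuous.
Qed.

Let continuous_lmul_fst a : continuous (fun p : H * H => lmul a p.1).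
Proof.
move=> u; apply: (@continuous_comp _ _ _ fst (lmul a)); first by apply: cvg_fst.
exact: gns_lmul_cont.
Qed.

Let continuous_lmul_snd a : continuous (fun p : H * H => lmul a p.2).
Proof.
move=> u; apply: (@continuous_comp _ _ _ snd (lmul a)); first by apply: cvg_snd.
exact: gns_lmul_cont.
Qed.

Lemma Dgraph_phi y z i : Dgraph (N - 1) (y, z) -> Dgraph (- 1)
  (phi y i, qpow (half N) *: phi z i
     + (qpow (wt d i) * qpow (half (N - 1))) *: lmul (pd X F (tS i)) y).
Proof.
pose f (p : H * H) : H * H := (phi p.1 i, qpow (half N) *: phi p.2 i
     + (qpow (wt d i) * qpow (half (N - 1))) *: lmul (pd X F (tS i)) p.1).
suff h p : Dgraph (N - 1) p -> Dgraph (- 1) (f p) by move=> /h.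
apply: (closure_map (f := f)).
  move=> u; apply: cvg_pair; first exact/continuousZ/continuous_lmul_fst.
  apply: cvgD; apply: continuousZ; last exact: continuous_lmul_fst.
  exact/continuousZ/continuous_lmul_snd.
move=> _ [x xm ->]; apply: subset_closure; exists (phiA W N x i 0).
  by have := M_phiA q_gt0 q_neq1 H i xm; rewrite addrAC subrr add0r.
rewrite /f /= (pdF_phiA q_gt0 q_neq1 H i xm) !phi_emb /embcol.
by congr pair; rewrite linearD !linearZ /= gns_lmulP.
Qed.

Lemma Dgraph_psi x z : (forall i, Dgraph (- 1) (x i, z i)) ->
  Dgraph (N - 1) (psi x, \sum_(i < d.+1) qpow (- wt d i) *:
    (qpow (- half N) *: lmul (tN i) (z i)
     + qpow (half (- 1)) *: lmul (pd X F (tN i)) (x i))).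
Proof.
move=> xz; apply: Dgraph_sum => // i.
pose f (p : H * H) : H * H := (qpow (- wt d i) *: lmul (tN i) p.1,
  qpow (- wt d i) *: (qpow (- half N) *: lmul (tN i) p.2
     + qpow (half (- 1)) *: lmul (pd X F (tN i)) p.1)).
suff h p : Dgraph (- 1) p -> Dgraph (N - 1) (f p) by apply: (h (x i, z i)).
apply: (closure_map (f := f)).
  move=> u; apply: cvg_pair; first exact/continuousZ/continuous_lmul_fst.
  apply: continuousZ => v.
  by apply: cvgD; apply: continuousZ; [apply: continuous_lmul_snd|apply: continuous_lmul_fst].
move=> _ [y ym ->]; apply: subset_closure.
exists (qpow (- wt d i) *: (tN i * y)).
  by apply: M_Z => //; apply: M_mul => //; apply: M_tN.
rewrite /f /= !gns_lmulP; congr pair; first by rewrite linearZ.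
by rewrite !linearZ /= (pdF_psi_term q_gt0 q_neq1 H i ym) !linearD !linearZ.
Qed.

(** Multiplying an approximating family by the entries of t^* or of t carries
    one closed graph into the other: the additional Leibniz terms, in which
    partial_F hits these entries, are bounded operators of the first component,
    and they cancel in the sum by unitarity. *)
Lemma PdFP_E x w : PdFP (x, w) <-> exists y z,
  [/\ Dgraph (N - 1) (y, z), x = phi y & w = phi (qpow (half N) *: z)].
Proof.
split=> [[/= /PMbarE [y yk ->] [z' []]]|[y [z [yz -> ->]]]].
  rewrite mulcolE phiK => /= yz' ->; rewrite mulcolE.
  exists y; exists (qpow (- half N) *: psi z'); split=> //; last first.
    by rewrite scalerA -qpowD // subrr qpow0 scale1r.
  have := Dgraph_psi yz'; rewrite phiK; congr (Dgraph _ (_, _)).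
  under eq_bigr => i _ do rewrite scalerDr.
  rewrite big_split /= [X in _ + X](_ : _ = 0) ?addr0.
    by rewrite scaler_sumr; apply: eq_bigr => i _; rewrite !scalerA mulrC.
  transitivity (qpow (half (- 1)) *: lmul (\sum_i pd X F (tN i) * tS i) y).
    rewrite lmul_suml scaler_sumr; apply: eq_bigr => i _.
    by rewrite lmulM /phi lmulZ !scalerA mulrAC -qpowD // addNr qpow0 mul1r.
  by rewrite pdF_tN_tS // lmul0l scaler0.
split=> /=; first by apply/PMbarE; exists y => //; rewrite addrC; apply: Dgraph_dom yz.
rewrite mulcolE phiK.
exists (fun i => qpow (half N) *: phi z i
     + (qpow (wt d i) * qpow (half (N - 1))) *: lmul (pd X F (tS i)) y).
split=> [i|]; first exact: Dgraph_phi.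
rewrite mulcolE psiD psiZ phiK; congr phi.
rewrite -[LHS]addr0; congr (_ + _).
rewrite -(scaler0 _ (qpow (half (N - 1)))) -(lmul0l y).
rewrite -(tN_pdF_tS q_gt0 q_neq1 X H N) lmul_suml scaler_sumr.
apply: eq_bigr => i _; rewrite linearZ /= scalerA lmulM mulrA -qpowD // addNr.
by rewrite qpow0 mul1r.
Qed.

End Transport.

(** * Solving for the kernel of the adjoint *)

Section Neumann.
Context {R : realType}.
Variables (q : R) (A : OSUq2 q) (W : peter_weyl A) (H : gns_space W).
Local Notation C := R[i].
Local Notation emb := (gns_emb H).
Local Notation ip := (ip H).

Lemma geometric_small (s e b : C) : 0 <= s < 1 -> 0 < e -> 0 <= b ->
  exists n, s ^+ n * b < e.
Proof.
move=> /andP[s0 s1] e0 b0; have b1 : 0 < b + 1 by rewrite ltr_wpDl.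
pose r := complex.Re s; have rs : r%:C = s by rewrite RRe_real // ger0_real.
pose f := complex.Re (e / (b + 1)).
have fe : f%:C = e / (b + 1) by rewrite RRe_real // gtr0_real // divr_gt0.
have r0 : 0 <= r by rewrite -ler0c rs.
have r1 : `|r| < 1 by rewrite ger0_norm // -ltcR rs.
have f0 : 0 < f by rewrite -ltcR fe divr_gt0.
have /cvgr0_norm_lt/(_ _ f0) [n _ /(_ n (leqnn n)) /= rn] := cvg_expr r1.
exists n; apply: (@le_lt_trans _ _ (s ^+ n * (b + 1))).
  by rewrite ler_wpM2l ?exprn_ge0 // lerDl.
rewrite -ltr_pdivlMr // -fe -rs -rmorphXn /= ltcR.
by move: rn; rewrite ger0_norm // exprn_ge0.
Qed.

(** The Neumann iteration x |-> x + lam (w - B x) makes the defect w - B x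
    decay geometrically. It never leaves V; when V is a weight space, the
    approximate solutions therefore have the weight of w. *)
Lemma neumann_dense (V : set A) (B : {linear A -> A}) lam s w :
  (forall c x y, V x -> V y -> V (c *: x + y)) -> (forall x, V x -> V (B x)) ->
  0 <= s < 1 ->
  (forall x, V x -> ip (x - lam *: B x) (x - lam *: B x) <= s * ip x x) ->
  V w -> closure ((emb \o B) @` V) (emb w).
Proof.
move=> Vlin VB s01 contr Vw; have s0 : 0 <= s by case/andP: s01.
have approx n : exists2 v, V v & ip (w - B v) (w - B v) <= s ^+ n * ip w w.
  elim: n => [|n [v Vv IH]].
    exists 0; last by rewrite linear0 subr0 mul1r.
    by have := Vlin (- 1) w w Vw Vw; rewrite scaleN1r addNr.
  pose r := w - B v; have Vr : V r.
    by rewrite /r addrC -scaleN1r; apply: Vlin => //; apply: VB.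
  exists (lam *: r + v); first exact: Vlin.
  have -> : w - B (lam *: r + v) = r - lam *: B r.
    by rewrite linearP opprD addrCA addrC.
  by rewrite (le_trans (contr _ Vr)) // exprS -mulrA ler_wpM2l.
apply/closureP => e e0.
have [n sn] := geometric_small s01 (exprn_gt0 2 e0) (dnorm_ge0 (gns_dot H) (emb w)).
have [v Vv vn] := approx n; exists (emb (B v)); split; first by exists v.
rewrite -(@ltr_pXn2r _ 2) ?nnegrE ?(ltW e0) // -linearB normr_emb.
exact: le_lt_trans vn sn.
Qed.

End Neumann.

Section Gram.
Context {R : realType}.
Variables (q : R).
Hypotheses (q_gt0 : 0 < q) (q_neq1 : q != 1).
Variables (U : UqSU2 q) (A : OSUq2 q) (W : peter_weyl A).
Variables (X : uq_actions U W) (H : gns_space W) (N : int).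
Local Notation C := R[i].
Local Notation emb := (gns_emb H).
Local Notation dot := (gns_dot H).
Local Notation lmul := (@gns_lmul _ _ _ _ H).
Local Notation ip := (ip H).
Local Notation qpow := (qpow q).
Local Notation M_ := (M_ X).
Local Notation K := (uK U).
Local Notation d := (`|N|%N).
Local Notation tN := (tN W (N := N)).
Local Notation tS := (tS W (N := N)).
Local Notation phi := (@phi _ _ _ _ H N).

(** Left multiplication by this element of the quantum sphere is phi^* phi,
    which need not be 1 as P_N need not be self-adjoint. The vectors phi z of
    ker T^* are those for which gram z lies in the cokernel of partial_F. *)
Definition gram : A := \sum_(i < d.+1) qpow (wt d i * 2) *: (tN i * tS i).

Lemma gram_dot x y : dot (lmul gram x) y = cdot dot (phi x) (phi y).
Proof.
rewrite /gram lmul_suml linear_sumlz /=; apply: eq_bigr => i _.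
rewrite lmulZl lmulM linearZl_LR /= dot_lmul /phi linearZl_LR linearZr_LR /=.
by rewrite conjC_real mulrA -qpowD // mulr_natr mulr2n.
Qed.

Lemma gram_inj x : lmul gram x = 0 -> x = 0.
Proof.
move=> x0; apply: (phi_inj q_gt0 (N := N)); rewrite phi0; apply/funext => i.
have := gram_dot x x; rewrite x0 linear0l => /esym/psumr_eq0P h.
by apply/eqP; rewrite -(dnorm_eq0 dot); apply/eqP/h.
Qed.

Lemma M_gram m x : M_ m x -> M_ m (gram * x).
Proof.
move=> xm; rewrite -[m]add0r; apply: M_mul => //; rewrite -(subrr N).
by apply: M_sum => // i _; apply: M_Z => //; apply: M_mul => //;
  [apply: M_tN|apply: M_tS].
Qed.

Lemma actK_gram : act X K gram = gram.
Proof.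
rewrite linear_sum; apply: eq_bigr => i _; rewrite linearZ /= actK_mul //.
rewrite actK_t // actK_star // -scalerAl -scalerAr !scalerA -mulrA.
by rewrite -qpowD // subrr qpow0 mulr1.
Qed.

Definition weight_space m c : set A := [set x | M_ m x /\ act X K x = c *: x].

Lemma weight_space_lin m c a x y : weight_space m c x -> weight_space m c y ->
  weight_space m c (a *: x + y).
Proof.
move=> [xm xc] [ym yc]; split; first exact: M_lin.
by rewrite (linearP (act X K)) /= xc yc scalerDr !scalerA mulrC.
Qed.

Lemma weight_space_gram m c x : weight_space m c x -> weight_space m c (gram * x).
Proof.
move=> [xm xc]; split; first exact: M_gram.
by rewrite actK_mul // actK_gram xc -scalerAr.
Qed.

(** The terms q^(2i) |t_i^* x|^2 are compared with |t_i^* x|^2, whose sum is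
    |x|^2. *)
Lemma gram_coercive : exists2 kap : C, 0 < kap &
  forall x, kap * ip x x <= ip (gram * x) x.
Proof.
pose S := \sum_(i < d.+1) (qpow (wt d i * 2))^-1.
have S0 : 0 < S.
  rewrite /S (bigD1 ord0) //= ltr_pwDl ?invr_gt0 ?qpow_gt0 //.
  by apply: sumr_ge0 => i _; rewrite invr_ge0 ltW // qpow_gt0.
exists S^-1; first by rewrite invr_gt0.
move=> x; have gE : ip (gram * x) x =
    \sum_(i < d.+1) qpow (wt d i * 2) * ip (tS i * x) (tS i * x).
  rewrite mulr_suml ip_suml; apply: eq_bigr => i _.
  by rewrite -scalerAl ipZl -mulrA (ip_mul_star _ (tN i)).
have xE : ip x x = \sum_(i < d.+1) ip (tS i * x) (tS i * x).
  rewrite -{1}[x]mul1r -(tN_tS W N) mulr_suml ip_suml; apply: eq_bigr => i _.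
  by rewrite -mulrA (ip_mul_star _ (tN i)).
rewrite gE xE mulr_sumr; apply: ler_sum => i _.
apply: ler_wpM2r; first exact: dnorm_ge0.
rewrite -[leRHS]invrK lef_pV2 ?posrE ?invr_gt0 ?qpow_gt0 //.
rewrite /S (bigD1 i) //= lerDl; apply: sumr_ge0 => j _.
by rewrite invr_ge0 ltW // qpow_gt0.
Qed.

(** Lax-Milgram: a bounded coercive operator becomes a contraction after
    subtraction of a small multiple from 1. The solution is a limit of weight
    vectors of the weight of w, which puts it into the domain of K^2. *)
Lemma gram_solve m c w : weight_space m c w ->
  exists z, closure (emb @` weight_space m c) z /\ lmul gram z = emb w.
Proof.
move=> wV; have [kap kap0 coer] := gram_coercive.
have [b b0 bd] := continuous_bound (@lmul_is_linear _ _ _ _ H gram)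
  (@gns_lmul_cont _ _ _ _ H gram).
pose B : {linear A -> A} := HB.pack_for {linear A -> A} ( *%R gram)
  (GRing.isLinear.Build _ _ _ _ ( *%R gram) (fun c x y => etrans (mulrDr _ _ _)
    (congr1 (fun z => z + gram * y) (esym (scalerAr c gram x))))).
have kapR : kap^* = kap by rewrite conj_Creal // gtr0_real.
(* With lam = kap / beta the expansion of the square gives the factor
   1 - 2 kap^2 / beta + b^2 kap^2 / beta^2, at most 1 - kap^2 / beta; the
   summand kap^2 of beta keeps this bound nonnegative. *)
pose beta := b ^+ 2 + kap ^+ 2.
have beta0 : 0 < beta by rewrite addr_gt0 // exprn_gt0.
pose lam := kap / beta; have lam0 : 0 < lam by rewrite divr_gt0.
pose s := 1 - kap ^+ 2 / beta.
have s01 : 0 <= s < 1.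
  rewrite subr_ge0 ler_pdivrMr // mul1r lerDr exprn_ge0 ?(ltW b0) //=.
  by rewrite ltrBlDr ltrDl divr_gt0 // exprn_gt0.
have contr x : ip (x - lam *: B x) (x - lam *: B x) <= s * ip x x.
  have gx := coer x; have x0 : 0 <= ip x x by exact: dnorm_ge0.
  have gR : (ip (gram * x) x)^* = ip (gram * x) x.
    by rewrite conj_Creal // ger0_real // (le_trans _ gx) // mulr_ge0 // ltW.
  have gg : ip (gram * x) (gram * x) <= beta * ip x x.
    rewrite -!normr_emb -gns_lmulP.
    apply: (@le_trans _ _ ((b * `|emb x|) ^+ 2)).
      by rewrite lerXn2r ?nnegrE ?mulr_ge0 // ltW.
    by rewrite exprMn ler_wpM2r ?exprn_ge0 // lerDl exprn_ge0 // ltW.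
  have -> : ip (x - lam *: B x) (x - lam *: B x) =
      ip x x - lam * ip (gram * x) x * 2 + lam ^+ 2 * ip (gram * x) (gram * x).
    pose g := ip (gram * x) x.
    have lR : lam^* = lam by rewrite conj_Creal // gtr0_real.
    have e1 : dot (emb x) (emb (lam *: B x)) = lam * g.
      by rewrite linearZ linearZr_LR /= lR -/(ip _ _) ipC gR.
    have e2 : dot (emb (lam *: B x)) (emb (lam *: B x)) =
        lam ^+ 2 * ip (gram * x) (gram * x).
      by rewrite linearZ linearZl_LR linearZr_LR /= lR mulrA.
    rewrite /ip linearB dnormB e1 e2 rmorphM /= lR gR -/(ip _ _).
    by ring.
  apply: (@le_trans _ _ (ip x x - lam * (kap * ip x x) * 2 + lam ^+ 2 * (beta * ip x x))).
    apply: lerD; last by rewrite ler_wpM2l // exprn_ge0 // ltW.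
    by rewrite lerD2l lerN2 ler_wpM2r // ler_wpM2l // ltW.
  rewrite le_eqVlt; apply/orP; left; apply/eqP; rewrite /s /lam.
  by field; rewrite gt_eqF.
have zcl : closure ((emb \o B) @` weight_space m c) (emb w).
  apply: (neumann_dense (lam := lam) (s := s)) => //.
  - by move=> a x y; apply: weight_space_lin.
  - by move=> x; apply: weight_space_gram.
have bound x : `|emb x| <= kap^-1 * `|(emb \o B) x|.
  have [->|x0] := eqVneq (emb x) 0; first by rewrite normr0 mulr_ge0 // invr_ge0 ltW.
  rewrite ler_pdivlMl // -(@ler_pM2r _ `|emb x|) ?normr_gt0 // -mulrA -expr2 normr_emb.
  apply: le_trans (coer x) _; rewrite -[leLHS]ger0_norm ?dot_bound //.
  by apply: le_trans (coer x); apply: mulr_ge0; [exact: ltW|exact: dnorm_ge0].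
have kap1 : 0 <= kap^-1 by rewrite invr_ge0 ltW.
have Vsub x y : weight_space m c x -> weight_space m c y -> weight_space m c (x - y).
  by move=> xV yV; rewrite [x - y]addrC -scaleN1r; apply: weight_space_lin.
have [z zw] := complete_preimage kap1 Vsub (fun x _ => bound x) zcl.
exists z; split.
  apply: (closure_map (f := fst) _ _ zw); first by move=> u; apply: cvg_fst.
  by move=> _ [x xV <-] /=; apply: subset_closure; exists x.
apply/eqP; rewrite -subr_eq0; apply/eqP/(dense_orth (H := H)) => a.
rewrite linearBl /= dot_lmul gns_lmulP.
have -> : dot (emb w) (emb a) = dot z (emb (ostar gram * a)).
  apply: (graph_adjoint _ zw (p := (z, emb w))) => _ [x _ <-] /=.
  by rewrite -!/(ip _ _) ip_mul_star.
by rewrite subrr.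
Qed.

End Gram.

(** * The index and the q-index *)

Section Index.
Context {R : realType}.
Variables (q : R).
Hypotheses (q_gt0 : 0 < q) (q_neq1 : q != 1).
Variables (U : UqSU2 q) (A : OSUq2 q) (W : peter_weyl A).
Variables (X : uq_actions U W) (H : gns_space W) (N : int).
Local Notation C := R[i].
Local Notation emb := (gns_emb H).
Local Notation dot := (gns_dot H).
Local Notation lmul := (@gns_lmul _ _ _ _ H).
Local Notation ip := (ip H).
Local Notation qpow := (qpow q).
Local Notation M_ := (M_ X).
Local Notation Mbar := (Mbar X H).
Local Notation PMbar := (PMbar X H N).
Local Notation PdFP := (PdFP X H N).
Local Notation Dgraph := (Dgraph X H).
Local Notation K := (uK U).
Local Notation F := (uF U).
Local Notation half m := (m%:~R / 2 : R).
Local Notation d := (`|N|%N).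
Local Notation phi := (@phi _ _ _ _ H N).
Local Notation psi := (@psi _ _ _ _ H N).
Local Notation gram := (gram W N).
Local Notation u k := (kervec W N (k : 'I_(kerdim N))).
Local Notation w k := (cokervec W N (k : 'I_(cokerdim N))).

Let lam := qpow (half N).
Let lam0 : lam != 0. Proof. exact: qpow_neq0. Qed.

Lemma PMbar_m1 x : PMbar (- 1) x <-> exists2 y, Mbar (N - 1) y & x = phi y.
Proof. by rewrite PMbarE // addrC. Qed.

Lemma PMbar_1 x : PMbar 1 x <-> exists2 y, Mbar (N + 1) y & x = phi y.
Proof. by rewrite PMbarE // addrC. Qed.

Lemma PdFP_ker x : gker PdFP x <-> exists2 y, Dgraph (N - 1) (y, 0) & x = phi y.
Proof.
split=> [/(PdFP_E q_gt0 q_neq1) [y [z [yz -> z0]]]|[y y0 ->]].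
  exists y => //; move: z0; rewrite -(phi0 H N) => /(phi_inj q_gt0) /esym/eqP.
  by rewrite scaler_eq0 (negbTE lam0) => /eqP <-.
by apply/PdFP_E => //; exists y, 0; rewrite scaler0 phi0.
Qed.

Lemma PdFP_ran x : gran PdFP x <-> exists z,
  [/\ Mbar (N + 1) z, forall k, dot z (emb (w k)) = 0 & x = phi z].
Proof.
split=> [[v /(PdFP_E q_gt0 q_neq1) [y [z [yz _ ->]]]]|[z [zm z0 ->]]].
  have [zm z0] := (Dgraph_range q_gt0 q_neq1 X N z).1 (ex_intro _ y yz).
  exists (lam *: z); split => // [|k]; first exact: Mbar_Z.
  by rewrite linearZl_LR /= z0 mulr0.
have zm' : Mbar (N + 1) (lam^-1 *: z) by apply: Mbar_Z.
have z0' k : dot (lam^-1 *: z) (emb (w k)) = 0 by rewrite linearZl_LR /= z0 mulr0.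
have [y yz] := (Dgraph_range q_gt0 q_neq1 X N _).2 (conj zm' z0').
exists (phi y); apply/PdFP_E => //; exists y, (lam^-1 *: z); split => //.
by rewrite scalerA mulfV // scale1r.
Qed.

Lemma PdFP_is_operator : is_operator (PMbar (- 1)) (PMbar 1) PdFP.
Proof.
split.
- move=> [x y] xy; split; first by case: xy.
  have /PdFP_ran [z [zm _ /= ->]] : gran PdFP y by exists x.
  by apply/PMbar_1; exists z.
- apply/PdFP_E => //; exists 0, 0; rewrite scaler0 phi0; split => //.
  exact: Dgraph_0.
- move=> c x y x' y' /(PdFP_E q_gt0 q_neq1) [a [b [ab -> ->]]].
  move=> /(PdFP_E q_gt0 q_neq1) [a' [b' [ab' -> ->]]].
  apply/PdFP_E => //; exists (c *: a + a'), (c *: b + b'); split.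
  + exact: (Dgraph_lin q_gt0 (c := c) ab ab').
  + by rewrite phi_linear.
  + by rewrite -phi_linear scalerDr !scalerA mulrC.
- move=> x y y' /(PdFP_E q_gt0 q_neq1) [a [b [ab -> ->]]].
  move=> /(PdFP_E q_gt0 q_neq1) [a' [b' [ab' /(phi_inj q_gt0) aa' ->]]].
  by rewrite -aa' in ab'; rewrite (Dgraph_fun q_gt0 q_neq1 ab ab').
Qed.

Lemma PdFP_dense : PMbar (- 1) `<=` col_closure (gdom PdFP).
Proof.
move=> _ /PMbar_m1 [y ym ->].
have cp := @phi_continuous _ _ _ _ H N.
apply: (closure_map cp _ ym) => _ [a am <-]; apply: subset_closure.
exists (phi (lam *: emb (pd X F a))); apply/PdFP_E => //.
by exists (emb a), (emb (pd X F a)); split => //; apply: Dgraph_emb.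
Qed.

Lemma ker_basis : is_basis (gker PdFP) (fun k => phi (emb (u k))).
Proof.
split=> [c c0 l|].
  have : \sum_k c k *: u k = 0.
    apply: (emb_inj q_gt0 q_neq1 (H := H)); apply: (phi_inj q_gt0 (N := N)).
    rewrite linear_sum linear0 phi0 -[RHS]c0 -phi_sum; congr phi.
    by apply: eq_bigr => k _; rewrite linearZ.
  move/(congr1 (fun x => ip x (u l))); rewrite ip0l ip_suml (bigD1 l) //= big1.
    by rewrite ipZl kervec_orthonormal // eqxx mulr1 addr0.
  by move=> k kl; rewrite ipZl kervec_orthonormal // (negbTE kl) mulr0.
apply/seteqP; split=> x.
  move=> /PdFP_ker [y /(Dgraph_ker q_gt0 q_neq1) [c ->] ->].
  by exists c; rewrite phi_sum.
move=> [c ->]; apply/PdFP_ker; exists (\sum_k c k *: emb (u k)).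
  by apply/Dgraph_ker => //; exists c.
by rewrite phi_sum.
Qed.

Let dot_w_sum (c : 'I_(cokerdim N) -> C) l :
  dot (\sum_k c k *: emb (w k)) (emb (w l)) = c l.
Proof.
rewrite linear_sumlz /= (bigD1 l) //= big1 => [|k kl].
  by rewrite linearZl_LR /= -/(ip _ _) cokervec_orthonormal // eqxx mulr1 addr0.
by rewrite linearZl_LR /= -/(ip _ _) cokervec_orthonormal // (negbTE kl) mulr0.
Qed.

Let orthw (x : H) : H := orthpart (fun k : 'I_(cokerdim N) => w k) x.

Let orthw_dot x k : dot (orthw x) (emb (w k)) = 0.
Proof. by apply: dot_orthpart => i j; apply: cokervec_orthonormal. Qed.

Let Mbar_orthw x : Mbar (N + 1) x -> Mbar (N + 1) (orthw x).
Proof.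
move=> xm; rewrite /orthw /orthpart [x - _]addrC -scaleN1r; apply: Mbar_lin => //.
by apply: Mbar_sum => // k _; apply: Mbar_Z => //; apply: Mbar_emb; apply: M_cokervec.
Qed.

Lemma ran_codim : has_codim (PMbar 1) (gran PdFP) (cokerdim N).
Proof.
exists (fun k => phi (emb (w k))); split.
- move=> k; apply/PMbar_1; exists (emb (w k)) => //.
  by apply: Mbar_emb; apply: M_cokervec.
- move=> c /PdFP_ran [z [_ z0 e]] k; rewrite -(z0 k).
  by move: e; rewrite -phi_sum => /(phi_inj q_gt0) <-.
- move=> _ /PMbar_1 [z zm ->]; exists (phi (orthw z)), (fun k => dot z (emb (w k))).
  split; first by apply/PdFP_ran; exists (orthw z); split => //; apply: Mbar_orthw.
  rewrite -phi_sum -[phi (orthw z)]scale1r addrC; apply/esym.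
  by rewrite addrC -phi_linear scale1r subrK.
Qed.

Lemma index_int : N = (kerdim N)%:Z - (cokerdim N)%:Z.
Proof. by clear; rewrite /kerdim /cokerdim; case: ifP; case: ifP; lia. Qed.

(** On algebraic columns everything reduces to phi and partial_F, which commute
    with the action. *)
Lemma PdFP_equivariant : commutes_with_Uq X H PdFP.
Proof.
move=> f x y /(PdFP_E q_gt0 q_neq1) [a [b [ab xa yb]]].
have embcol_inj (v v' : 'cV[A]_d.+1) : embcol H v = embcol H v' -> v = v'.
  move=> e; apply/matrixP => i j; rewrite (ord1 j).
  by apply: (emb_inj q_gt0 q_neq1 (H := H)); have /= := congr1 (fun h => h i) e.
have aE : a = emb (psiA W x) by rewrite -psi_embcol xa phiK.
rewrite {}aE in ab xa; move: (psiA W x) xa ab => {}a xa ab.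
have am : M_ (N - 1) a by apply: (emb_Mbar q_gt0 q_neq1 (H := H)); apply: Dgraph_dom ab.
rewrite {b ab}(Dgraph_fun q_gt0 q_neq1 ab (Dgraph_emb (H := H) am)) in yb.
move: xa; rewrite phi_emb => /embcol_inj ->.
move: yb; rewrite -linearZ /= phi_emb => /embcol_inj ->.
rewrite !phiA_act // (linearZ_LR (act X f)) /= -pd_act -!phi_emb.
apply/PdFP_E => //; exists (emb (act X f a)), (emb (pd X F (act X f a))).
by split => //; [apply: Dgraph_emb; apply: M_act|rewrite linearZ].
Qed.

Lemma actK2 c y : act X K y = c *: y -> act X (K ^+ 2) y = c ^+ 2 *: y.
Proof.
by move=> e; rewrite expr2 (rep_mul (act_rep X)) e linearZ /= e scalerA.
Qed.

(** phi is continuous and equivariant, so approximating z by weight vectors of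
    the algebra approximates (phi z, c^2 phi z) in the graph of K^2. *)
Lemma K2bar_phi k c z : closure (emb @` weight_space X (k + N) c) z ->
  K2bar X H d k (phi z, c ^+ 2 *: phi z).
Proof.
have cp := @phi_continuous _ _ _ _ H N.
have cp' : continuous (fun y : H => phi (c ^+ 2 *: y) : {ptws 'I_d.+1 -> H}).
  move=> y; apply: (@continuous_comp H H {ptws 'I_d.+1 -> H} (fun y => c ^+ 2 *: y) phi); last exact: cp.
  exact: scaler_continuous.
pose f (z : H) : {ptws 'I_d.+1 -> H} * {ptws 'I_d.+1 -> H} :=
  (phi z, phi (c ^+ 2 *: z)).
rewrite -phiZ; move: z; apply: (closure_map (f := f)).
  by move=> y; apply: (cvg_pair (cp y) (cp' y)).
move=> _ [a [am ac] <-]; apply: subset_closure; exists (phiA W N a).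
split=> [i|]; last by rewrite phiA_act // (actK2 ac) /f -linearZ /= !phi_emb.
by have := M_phiA q_gt0 q_neq1 H i am; rewrite addrK.
Qed.

Lemma cdotC m (x y : 'I_m -> H) : cdot dot x y = (cdot dot y x)^*.
Proof.
by rewrite /cdot rmorph_sum; apply: eq_bigr => i _; rewrite dotC.
Qed.

Lemma weight_w (k : 'I_(cokerdim N)) :
  weight_space X (N + 1) (qpow (wt d.-1 k)) (w k).
Proof. by split; [apply: M_cokervec|rewrite actK_vv]. Qed.

Lemma trace_diag m (V : set ('I_d.+1 -> H)) G (e : 'I_m -> 'I_d.+1 -> H) (c : 'I_m -> C) :
  is_basis V e -> (forall k, G (e k, c k *: e k)) -> has_trace V G (\sum_k c k).
Proof.
move=> Ve Ge; exists m, e, (\matrix_(i, j) (c j *+ (i == j))).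
split => // [j|]; last first.
  by apply: eq_bigr => k _; rewrite mxE eqxx.
rewrite (bigD1 j) //= big1 => [|i ij].
  by rewrite mxE eqxx addr0.
by rewrite mxE (negbTE ij) scale0r.
Qed.

Lemma ker_trace : has_trace (gker PdFP) (K2bar X H d (- 1))
  (\sum_(k < kerdim N) qpow (wt d.-1 k) ^+ 2).
Proof.
apply: trace_diag ker_basis _ => k; apply: K2bar_phi; apply: subset_closure.
exists (u k) => //; split; last by rewrite actK_vv.
by rewrite addrC; apply: M_kervec.
Qed.

(** A column phi x is orthogonal to the range of T iff gram x is orthogonal to
    the range of partial_F, that is, iff gram x is a combination of the cokernel
    vectors w k. Solving gram (z k) = w k gives the basis phi (z k), whose
    members have the same weights as the w k. *)
Lemma coker_trace :
  has_trace (gker (adjoint dot (PMbar (- 1)) (PMbar 1) PdFP)) (K2bar X H d 1)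
  (\sum_(k < cokerdim N) qpow (wt d.-1 k) ^+ 2).
Proof.
have [z zP] := fin_all_exists (fun k => gram_solve q_gt0 q_neq1 H N (weight_w k)).
have gz (c : 'I_(cokerdim N) -> C) :
    lmul gram (\sum_k c k *: z k) = \sum_k c k *: emb (w k).
  rewrite linear_sum; apply: eq_bigr => k _; rewrite linearZ /=.
  by have [_ ->] := zP k.
have zm k : Mbar (N + 1) (z k).
  have [zV _] := zP k; apply: closureS zV => _ [a [am _] <-].
  by exists a.
apply: (trace_diag (e := fun k => phi (z k))) => [|k]; last first.
  by apply: K2bar_phi; rewrite addrC; have [] := zP k.
split=> [c|].
  rewrite -phi_sum -(phi0 H N) => /(phi_inj q_gt0) cz l.
  by rewrite -(dot_w_sum c l) -gz cz linear0 linear0l.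
apply/seteqP; split=> y.
  move=> [/= /PMbar_1 [x xm ->] _ yT].
  have orth v : Mbar (N + 1) v -> (forall k, dot v (emb (w k)) = 0) ->
      dot (lmul gram x) v = 0.
    move=> vm v0; rewrite gram_dot // cdotC.
    have [a aT] : gran PdFP (phi v) by apply/PdFP_ran; exists v.
    by rewrite (yT _ _ aT) /cdot big1 ?conjC0 // => i _; rewrite linear0r.
  pose g := lmul gram x; have gm : Mbar (N + 1) g.
    apply: (closure_map (f := lmul gram)) xm; first exact: gns_lmul_cont.
    move=> _ [a am <-]; apply: subset_closure; exists (gram * a).
      exact: M_gram.
    by rewrite gns_lmulP.
  pose c k := dot g (emb (w k)); have gE : g = \sum_k c k *: emb (w k).
    apply/eqP; rewrite -subr_eq0 -(dnorm_eq0 dot); apply/eqP.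
    have -> : dot (g - \sum_k c k *: emb (w k)) (g - \sum_k c k *: emb (w k)) =
        dot g (orthw g) - dot (\sum_k c k *: emb (w k)) (orthw g).
      by rewrite -linearBl.
    rewrite orth; [|exact: Mbar_orthw|exact: orthw_dot].
    rewrite linear_sumlz /= big1 ?subr0 // => k _.
    by rewrite linearZl_LR /= dotC orthw_dot conjC0 mulr0.
  exists c; rewrite -phi_sum; congr phi; apply/eqP; rewrite -subr_eq0; apply/eqP.
  by apply: (gram_inj q_gt0 (H := H) (N := N)); rewrite linearB /= gz -gE subrr.
move=> [c ->]; rewrite -phi_sum; split=> /=.
- apply/PMbar_1; eexists; last reflexivity.
  by apply: Mbar_sum => // k _; apply: Mbar_Z.
- by apply/PMbar_m1; exists 0; rewrite ?phi0 //; apply: Mbar_0.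
move=> a b ab; have /PdFP_ran [v [_ v0 ->]] : gran PdFP b by exists a.
rewrite cdotC -gram_dot // gz linear_sumlz /= big1 => [|k _].
  by rewrite conjC0 /cdot big1 // => i _; rewrite linear0r.
by rewrite linearZl_LR /= dotC v0 conjC0 mulr0.
Qed.

Lemma qindex_sum : (qnum q N%:~R)%:C =
  \sum_(k < kerdim N) qpow (wt d.-1 k) ^+ 2
  - \sum_(k < cokerdim N) qpow (wt d.-1 k) ^+ 2.
Proof.
have sumE n : n = d -> (0 < n)%N ->
    \sum_(k < n) qpow (wt d.-1 k) ^+ 2 = (qnum q d%:R)%:C.
  case: n => // n nd _; rewrite -nd -(sum_qpow_wt q_gt0 q_neq1).
  by apply: eq_bigr => k _; rewrite qpowM2.
have [N0|N0|N0] := ltgtP N 0.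
- rewrite big1 => [|k _]; last by have [? _] := kerdim_gt0 k; lia.
  rewrite sumE; last 2 first.
  + by rewrite /cokerdim N0.
  + by rewrite /cokerdim N0; lia.
  rewrite sub0r -rmorphN /=; congr (_%:C).
  have -> : N%:~R = - d%:R :> R by rewrite -[d%:R]/(d%:Z%:~R) -rmorphN; congr (_%:~R); lia.
  by rewrite /qnum opprK -mulNr opprB.
- rewrite sumE; last 2 first.
  + by rewrite /kerdim N0.
  + by rewrite /kerdim N0; lia.
  rewrite [X in _ - X]big1 => [|k _]; last by have [? _] := cokerdim_gt0 k; lia.
  rewrite subr0; congr (_%:C); congr qnum.
  by rewrite -[d%:R]/(d%:Z%:~R); congr (_%:~R); lia.
- rewrite !big1 => [||k _]; last by have [? _] := kerdim_gt0 k; lia.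
    by rewrite N0 /qnum oppr0 subrr mul0r subr0.
  by move=> k _; have [? _] := cokerdim_gt0 k; lia.
Qed.

End Index.

Theorem proposition7p2 (R : realType) (q : R) (q_gt0 : 0 < q) (q_neq1 : q != 1)
    (U : UqSU2 q) (A : OSUq2 q) (W : peter_weyl A) (X : uq_actions U W)
    (H : gns_space W) (N : int) :
  [/\ fredholm (PMbar X H N (- 1)) (PMbar X H N 1) (PdFP X H N),
      is_index (PMbar X H N 1) (PdFP X H N) N &
      is_qindex X H (PMbar X H N (- 1)) (PMbar X H N 1) (PdFP X H N)
        (qnum q N%:~R)%:C].
Proof.
have kerP : has_dim (gker (PdFP X H N)) (kerdim N).
  by eexists; apply: (ker_basis q_gt0 q_neq1 X H N).
have ranP := ran_codim q_gt0 q_neq1 X H N.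
split.
- split; first exact: PdFP_is_operator.
  + exact: PdFP_dense.
  + by exists (kerdim N).
  + by exists (cokerdim N).
- exists (kerdim N), (cokerdim N); split; [exact: kerP|exact: ranP|exact: index_int].
- split; first exact: PdFP_equivariant.
  do 2!eexists; split; [exact: ker_trace|exact: coker_trace|exact: qindex_sum].
Qed.
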